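(* Assume that for every $d\in\mathcal{X}$, $\nabla\ell(\cdot;d)$ is $(L,\lambda)$-Hölder continuous on $\mathcal{K}$ with $L\ge0$, $\lambda\in(0,1]$, and let $h$ be the inverse on $\mathbb{R}_{\ge0}$ of $x\mapsto x+\eta Lx^\lambda$. Fix any realization $\mathcal{B}=(\mathcal{B}_t)_{t=0}^{T-1}$ of the shuffled cyclic mini-batch sequence, fix adjacent datasets differing at index $i^\star$, and let $t_e$, $\mathcal{E}$ and $D_t$ be as in the context. Then for every $\alpha>1$, $D_\alpha(W_T\|W_T')\le\varepsilon(\alpha,\mathcal{B})$, where $$\varepsilon(\alpha,\mathcal{B})=\min_{\tau,\beta,a}\ \sum_{e\in\mathcal{E},\,t_e\ge\tau}\frac{\alpha(2K\eta/b)^2}{2\beta_{t_e}\sigma^2}+\sum_{t=\tau}^{T-1}\frac{\alpha a_t^2}{2\sigma^2(1-\beta_t)},$$ the minimum being over $\tau\in\{0,\dots,T-1\}$, $a_t\ge0$ for $t\ge\tau$, $\beta_t\in[0,1]$ for $t\in S_\tau:=\{t_e:e\in\mathcal{E},t_e\ge\tau\}$ and $\beta_t=0$ for $t\in\{\tau,\dots,T-1\}\setminus S_\tau$, subject to $A_\tau\ge D_\tau$, where $A_T=0$ and $A_{t-1}=h(A_t+a_{t-1})$ for $t=T,\dots,\tau+1$.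
   Context: Setting (Noisy-SGD). Let $\mathcal{K}\subset\mathbb{R}^d$ be a nonempty closed convex set of diameter $D$, $\Pi_{\mathcal{K}}$ the Euclidean projection. Let $\ell(\cdot;d)$, $d\in\mathcal{X}$, be differentiable losses on $\mathcal{K}$; for $\mathcal{D}=(d_1,\dots,d_n)$ write $\ell_i=\ell(\cdot;d_i)$. $\Pi_{B_K}(v)=v\min(1,K/\|v\|)$. Noisy-SGD: $W_{t+1}=\Pi_{\mathcal{K}}\big[W_t-\eta\frac1b\sum_{i\in\mathcal{B}_t}\Pi_{B_K}[\nabla\ell_i(W_t)]+G_t\big]$, $G_t$ i.i.d. $N(0,\sigma^2I_d)$ independent of everything else, $W_0\in\mathcal{K}$. Adjacent datasets differ in exactly one index $i^\star$; $W_t,W_t'$ are iterates on $\mathcal{D},\mathcal{D}'$ with the same $W_0$ and same batches. $D_\alpha(\mu\|\nu)=\frac1{\alpha-1}\log\int(\mu/\nu)^\alpha d\nu$ ($+\infty$ if $\mu\not\ll\nu$). $(L,\lambda)$-Hölder: $\|f(w)-f(w')\|\le L\|w-w'\|^\lambda$. Shuffled cyclic mini-batches: $b$ divides $n$, $B=n/b$; epoch $e\ge0$ consists of steps $t=eB,\dots,eB+B-1$; at the start of each epoch $[n]$ is partitioned uniformly at random (independently of data, noise and iterates) into $B$ batches $\mathcal{B}^e_0,\dots,\mathcal{B}^e_{B-1}$ of size $b$, and $\mathcal{B}_{eB+i}=\mathcal{B}^e_i$. For a realization, $t_e$ denotes the unique step in epoch $e$ with $i^\star\in\mathcal{B}_{t_e}$,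 and $\mathcal{E}=\{e\ge0: t_e\le T-1\}$. Distance recursion: $g(x;M)=x+Mx^\lambda$; $D_t=0$ if $t\le t_0$; $D_t=2\eta K/b$ if $t=t_0+1$; $D_t=\min\big(g(D_{t-1};\eta L(b-1)/b)+2\eta K/b,\ D_{t-1}+2\eta K\big)$ if $t-1\in\{t_e:e\ge1\}$; $D_t=\min\big(g(D_{t-1};\eta L),\ D_{t-1}+2\eta K\big)$ otherwise. Conventions: $x/0=+\infty$ for $x>0$, $0/0=0$. *)

(* Defs.v *)
From HB Require Import structures.
From mathcomp Require Import all_boot all_order all_algebra.
From mathcomp Require Import all_classical all_reals all_analysis.
Set Implicit Arguments.
Unset Strict Implicit.
Unset Printing Implicit Defensive.
Import Order.TTheory GRing.Theory Num.Theory.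
Import numFieldNormedType.Exports.
Local Open Scope classical_set_scope.
Local Open Scope ring_scope.

Section NoisySGD.
Variables (R : realType) (d : nat).
Notation vec := 'rV[R]_d.

Definition enorm (v : vec) : R := Num.sqrt (\sum_(i < d) v ord0 i ^+ 2).

Definition is_projection (K : set vec) (proj : vec -> vec) : Prop :=
  forall v, K (proj v) /\ forall w, K w -> enorm (v - proj v) <= enorm (v - w).

(* Pi_{B_K}(v) = v * min(1, K/||v||), with x/0 = +oo (so Pi_{B_K}(0) = 0) *)
Definition clip (K : R) (v : vec) : vec :=
  if enorm v == 0 then v else Num.min 1 (K / enorm v) *: v.

Fixpoint sgd_iter (X : Type) (n : nat) (proj : vec -> vec)
   (grad : X -> vec -> vec) (data : 'I_n -> X) (batch : nat -> {set 'I_n})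
   (eta K : R) (b : nat) (G : nat -> vec) (W0 : vec) (t : nat) : vec :=
  match t with
  | 0 => W0
  | t'.+1 =>
    let W := sgd_iter proj grad data batch eta K b G W0 t' in
    proj (W - eta *: (b%:R^-1 *: \sum_(i in batch t') clip K (grad (data i) W))
          + G t')
  end.

(* conversion of a row vector into a d-tuple, whose (product Borel)
   measurable structure is provided by mathcomp-analysis *)
Definition rv2tuple (v : vec) : d.-tuple R := [tuple v ord0 i | i < d].

End NoisySGD.

Section Renyi.
Context {R : realType} {dT : measure_display} {T : measurableType dT}.

Definition is_density (mu nu : set T -> \bar R) (f : T -> R) : Prop :=
  measurable_fun setT f /\ (forall x, 0 <= f x) /\
  forall A, measurable A -> mu A = (\int[nu]_(x in A) (f x)%:E)%E.

Definition eln (x : \bar R) : \bar R :=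
  match x with
  | +oo%E => +oo%E
  | -oo%E => -oo%E
  | r%:E => if 0 < r then (ln r)%:E else -oo%E
  end.

Definition renyi (alpha : R) (mu nu : set T -> \bar R) : \bar R :=
  match pselect (exists f, is_density mu nu f) with
  | left H => let f := projT1 (cid H) in
      ((alpha - 1)^-1)%:E * eln (\int[nu]_x ((f x) `^ alpha)%:E)
  | right _ => +oo%E
  end.
End Renyi.

Section Accounting.
Variable R : realType.

Definition ediv (x y : R) : \bar R :=
  if y == 0 then (if x == 0 then 0%E else +oo%E) else (x / y)%:E.

(* t_e : the unique step of epoch e whose batch contains istar *)
Definition tE (n : nat) (batch : nat -> {set 'I_n}) (b : nat) (istar : 'I_n)
   (e : nat) : nat :=
  let B := (n %/ b)%N in
  (e * B + odflt 0%N (omap val [pick i : 'I_B | istar \in batch (e * B + i)%N]))%N.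

Definition gfun (lam : R) (x M : R) : R := x + M * x `^ lam.

Fixpoint Dseq (n : nat) (batch : nat -> {set 'I_n}) (b : nat) (istar : 'I_n)
   (eta K L lam : R) (t : nat) : R :=
  let t0 := tE batch b istar 0 in
  match t with
  | 0 => 0
  | t'.+1 =>
    let Dp := Dseq batch b istar eta K L lam t' in
    if (t'.+1 <= t0)%N then 0
    else if t' == t0 then 2 * eta * K / b%:R
    else if `[< exists e, (1 <= e)%N /\ t' = tE batch b istar e >] then
      Num.min (gfun lam Dp (eta * L * (b%:R - 1) / b%:R) + 2 * eta * K / b%:R)
              (Dp + 2 * eta * K)
    else Num.min (gfun lam Dp (eta * L)) (Dp + 2 * eta * K)
  end.

(* backward recursion: Aback k = A_{T-k}, with A_T = 0 and
   A_{t-1} = h (A_t + a_{t-1}) *)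
Fixpoint Aback (h : R -> R) (a : nat -> R) (T k : nat) : R :=
  match k with
  | 0 => 0
  | k'.+1 => h (Aback h a T k' + a (T - k'.+1)%N)
  end.

Definition Aseq (h : R -> R) (a : nat -> R) (T t : nat) : R := Aback h a T (T - t).

End Accounting.

(* Main.v *)
(** The bound is obtained by a discrete Girsanov argument.  Run the iterates [w']
    on the second data set with noise [g], and next to them iterates [w] on the
    first data set with noise [g - s], where the shift [s t] is a function of the
    past noise.  From time [tau] on, [s t] moves [w] towards [w'] by at most [a t]
    and cancels the gradient difference, of norm at most [c = 2 Kc eta / b],
    whenever [istar] is in the batch.  Since [h] inverts the expansion bound of a
    gradient step, the distance of [w] and [w'] stays below [A], hence vanishes at
    time [T].  Girsanov's formula then expresses the law of [W_T] as that of [W'_T]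
    reweighted by a martingale density [M], so the Renyi divergence of order
    [alpha] is at most [log E(M^alpha) / (alpha - 1)], which is bounded through the
    pointwise bound on [s].  The sum over [beta] is the Cauchy-Schwarz inequality
    [(a + c)^2 <= c^2 / beta + a^2 / (1 - beta)]. *)

Require Import Defs.
From HB Require Import structures.
From mathcomp Require Import all_boot all_order all_algebra.
From mathcomp Require Import all_classical all_reals all_analysis.
From mathcomp Require Import measurable_realfun.
From mathcomp Require Import ring lra.
Import Order.TTheory GRing.Theory Num.Theory.
Import numFieldNormedType.Exports.
Local Open Scope classical_set_scope.
Local Open Scope ring_scope.
Set Implicit Arguments.
Unset Strict Implicit.
Unset Printing Implicit Defensive.

(** * Euclidean projections *)

Section Euclidean.
Variables (R : realType) (d : nat).
Implicit Types u v w : 'rV[R]_d.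

(** The shift is random, so the shifted noise does not have a product law. Two features make it
    tractable: [s t] reads only the noise before [t], and its norm obeys a bound valid for every
    noise path. Indeed [alpha * log M] is the log-weight of the shift [alpha * s] plus [(alpha - 1)
    * alpha * \sum s^2 / (2 * sigma^2)]. The first part exponentiates to a variable of mean one, by
    Girsanov's formula applied a second time, and the second part is bounded pointwise. Passing from
    the noise to [W_T] is conditional Jensen, obtained here from Young's inequality. The sequence
    [A] is a reachability bound: [A_t] is a distance from which the remaining moves
    [a_t, ..., a_{T-1}] still bring the two runs together, and [A_tau >= D_tau] says that this
    covers any distance accumulated before steering starts. *)

Definition dot u v : R := \sum_(i < d) u ord0 i * v ord0 i.

Lemma dotC u v : dot u v = dot v u.
Proof. by apply: eq_bigr => i _; rewrite mulrC. Qed.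

Lemma dotDl u v w : dot (u + v) w = dot u w + dot v w.
Proof. by rewrite -big_split; apply: eq_bigr => i _; rewrite mxE mulrDl. Qed.

Lemma dotZl k u v : dot (k *: u) v = k * dot u v.
Proof. by rewrite mulr_sumr; apply: eq_bigr => i _; rewrite mxE mulrA. Qed.

Lemma dotNl u v : dot (- u) v = - dot u v.
Proof. by rewrite -scaleN1r dotZl mulN1r. Qed.

Lemma dotDr u v w : dot w (u + v) = dot w u + dot w v.
Proof. by rewrite dotC dotDl !(dotC w). Qed.

Lemma dotZr k u v : dot v (k *: u) = k * dot v u.
Proof. by rewrite dotC dotZl (dotC v). Qed.

Lemma dotNr u v : dot v (- u) = - dot v u.
Proof. by rewrite dotC dotNl (dotC v). Qed.

Lemma dot_ge0 u : 0 <= dot u u.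
Proof. by apply: sumr_ge0 => i _; rewrite -expr2 sqr_ge0. Qed.

Lemma enorm_ge0 u : 0 <= enorm u.
Proof. exact: sqrtr_ge0. Qed.

Lemma enormE u : enorm u = Num.sqrt (dot u u).
Proof. by congr Num.sqrt; apply: eq_bigr => i _; rewrite expr2. Qed.

Lemma sqr_enorm u : enorm u ^+ 2 = dot u u.
Proof. by rewrite enormE sqr_sqrtr// dot_ge0. Qed.

Lemma enorm_le u v : (enorm u <= enorm v) = (dot u u <= dot v v).
Proof. by rewrite !enormE ler_psqrt// ?nnegrE ?dot_ge0. Qed.

Lemma enorm0 : enorm (0 : 'rV[R]_d) = 0.
Proof. by rewrite enormE /dot big1 ?sqrtr0// => i _; rewrite mxE mul0r. Qed.

Lemma coord_le_enorm u i : `|u ord0 i| <= enorm u.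
Proof.
rewrite -sqrtr_sqr ler_sqrt; last by apply: sumr_ge0 => j _; rewrite sqr_ge0.
by rewrite (bigD1 i)//= lerDl sumr_ge0// => j _; rewrite sqr_ge0.
Qed.

Lemma enorm_eq0 u : enorm u = 0 -> u = 0.
Proof.
move=> u0; apply/rowP => i; apply/eqP.
by rewrite mxE -normr_le0 -u0 coord_le_enorm.
Qed.

Lemma enormZ k u : enorm (k *: u) = `|k| * enorm u.
Proof.
by rewrite !enormE dotZl dotZr mulrA -expr2 sqrtrM ?sqr_ge0// sqrtr_sqr.
Qed.

Lemma enormN u : enorm (- u) = enorm u.
Proof. by rewrite -scaleN1r enormZ normrN1 mul1r. Qed.

(** Cauchy-Schwarz, by expanding the square of [enorm v *: u - enorm u *: v]. *)
Lemma dot_le u v : dot u v <= enorm u * enorm v.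
Proof.
have [u0|u0] := eqVneq (enorm u) 0.
  by rewrite (enorm_eq0 u0) enorm0 mul0r /dot big1// => i _; rewrite mxE mul0r.
have [v0|v0] := eqVneq (enorm v) 0.
  by rewrite (enorm_eq0 v0) enorm0 mulr0 /dot big1// => i _; rewrite mxE mulr0.
have up : 0 < enorm u by rewrite lt0r u0 enorm_ge0.
have vp : 0 < enorm v by rewrite lt0r v0 enorm_ge0.
have := dot_ge0 (enorm v *: u - enorm u *: v).
rewrite dotDl !dotDr !dotNl !dotNr !dotZl !dotZr (dotC v u) -!sqr_enorm.
have uv : 0 < enorm u * enorm v by rewrite mulr_gt0.
set a := enorm u in uv *; set b := enorm v in uv *; set c := dot u v => H.
rewrite -(ler_pM2l uv); nra.
Qed.

Lemma enormD u v : enorm (u + v) <= enorm u + enorm v.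
Proof.
rewrite -(@ler_pXn2r _ 2)// ?nnegrE ?addr_ge0 ?enorm_ge0//.
rewrite sqr_enorm dotDl !dotDr (dotC v u) sqrrD !sqr_enorm.
have := dot_le u v; lra.
Qed.

Lemma enorm_sum (I : Type) (r : seq I) (Q : pred I) (F : I -> 'rV[R]_d) :
  enorm (\sum_(i <- r | Q i) F i) <= \sum_(i <- r | Q i) enorm (F i).
Proof.
elim/big_ind2 : _ => //[|a b c e ab ce]; first by rewrite enorm0.
by rewrite (le_trans (enormD _ _))// lerD.
Qed.

Section projection.
Variables (K : set 'rV[R]_d) (p : 'rV[R]_d -> 'rV[R]_d).
Hypothesis Kconv : forall x y t, K x -> K y -> 0 <= t <= 1 -> K (x + t *: (y - x)).
Hypothesis pK : is_projection K p.

(** Moving from [p v] a fraction [t] towards [w] stays in [K], hence comes no closer to [v];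
    expanding squares and dividing by [t] leaves [2 * dot a b <= t * dot b b]. *)
Lemma projection_obtuse v w : K w -> dot (v - p v) (w - p v) <= 0.
Proof.
move=> Kw; have [a aE] : exists a, a = v - p v by exists (v - p v).
have [b bE] : exists b, b = w - p v by exists (w - p v).
rewrite -aE -bE.
have H t : 0 < t -> t <= 1 -> 2 * dot a b <= t * dot b b.
  move=> t0 t1; have [Kp pmin] := pK v.
  have /pmin : K (p v + t *: b).
    by rewrite bE; apply: Kconv => //; rewrite (ltW t0).
  rewrite opprD addrA -aE enorm_le dotDl !dotDr !dotNl !dotNr !dotZl !dotZr.
  rewrite (dotC b a) => H; rewrite -(ler_pM2l t0); nra.
rewrite leNgt; apply/negP => ab0.
(* An explicit small step instead of the limit [t -> 0]: it forces [t * dot b b < dot a b], and the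
   [+ 1] guards against [b = 0]. *)
pose t := Num.min 1 (dot a b / (dot b b + 1)).
have bb1 : 0 < dot b b + 1 by rewrite ltr_wpDl// dot_ge0.
have t0 : 0 < t by rewrite lt_min ltr01 divr_gt0.
have t1 : t <= 1 by rewrite ge_min lexx.
have := H _ t0 t1; apply/negP; rewrite -ltNge.
have tb : t <= dot a b / (dot b b + 1) by rewrite ge_min lexx orbT.
have : t * (dot b b + 1) <= dot a b by rewrite -ler_pdivlMr.
have := dot_ge0 b; nra.
Qed.

(** The obtuse-angle inequalities at [p u] and [p v] add up to [enorm e ^+ 2 <= dot (u - v) e];
    Cauchy-Schwarz then allows division by [enorm e]. *)
Lemma projection_nonexpansive u v : enorm (p u - p v) <= enorm (u - v).
Proof.
have := projection_obtuse u (pK v).1.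
have := projection_obtuse v (pK u).1.
have -> : p v - p u = - (p u - p v) by rewrite opprB.
have [e eE] : exists e, e = p u - p v by exists (p u - p v).
have := dot_le (u - v) e; have : dot e e = dot (p u) e - dot (p v) e.
  by rewrite {1}eE dotDl dotNl.
rewrite -eE !dotNr !dotDl !dotNl -sqr_enorm => H1 H2 H3 H4.
have [->|e0] := eqVneq (enorm e) 0; first exact: enorm_ge0.
have ep : 0 < enorm e by rewrite lt0r e0 enorm_ge0.
rewrite -(ler_pM2r ep); lra.
Qed.

Lemma projection_id x : K x -> p x = x.
Proof.
move=> Kx; have := (pK x).2 x Kx; rewrite subrr enorm0 => H.
apply/eqP; rewrite eq_sym -subr_eq0; apply/eqP/enorm_eq0/le_anti.
by rewrite H enorm_ge0.
Qed.

End projection.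

(** Through this identification clipping inherits nonexpansiveness, so clipped gradients keep the
    Hoelder constant [L]. *)
Lemma clip_is_projection (k : R) : 0 <= k ->
  @is_projection R d [set v : 'rV[R]_d | enorm v <= k] (@clip R d k).
Proof.
move=> k0 v; rewrite /clip; have [v0|v0] := eqVneq (enorm v) 0.
  split; first by rewrite /= v0.
  by move=> w _; rewrite subrr enorm0 enorm_ge0.
have vp : 0 < enorm v by rewrite lt0r v0 enorm_ge0.
rewrite minEle; case: ifPn => [|].
  rewrite ler_pdivlMr// mul1r => vk; rewrite scale1r; split=> //= w _.
  by rewrite subrr enorm0 enorm_ge0.
rewrite -ltNge ltr_pdivrMr// mul1r => vk.
have kv : 0 <= k / enorm v by rewrite divr_ge0// ltW.
split=> /= [|w wk]; first by rewrite enormZ ger0_norm// divfK.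
rewrite -[X in X - _]scale1r -scalerBl enormZ ger0_norm; last first.
  by rewrite subr_ge0 ler_pdivrMr// mul1r ltW.
rewrite mulrBl divfK// mul1r.
have := enormD (v - w) w; rewrite subrK; lra.
Qed.

Lemma ball_convex (k : R) (x y : 'rV[R]_d) t : enorm x <= k -> enorm y <= k ->
  0 <= t <= 1 -> enorm (x + t *: (y - x)) <= k.
Proof.
move=> xk yk /andP[t0 t1].
have -> : x + t *: (y - x) = (1 - t) *: x + t *: y.
  by rewrite scalerBr scalerBl scale1r addrA addrAC.
rewrite (le_trans (enormD _ _))// !enormZ !ger0_norm ?subr_ge0//.
have := enorm_ge0 x; have := enorm_ge0 y; nra.
Qed.

Lemma clip_nonexpansive (k : R) u v : 0 <= k ->
  enorm (clip k u - clip k v) <= enorm (u - v).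
Proof.
move=> k0; apply: (projection_nonexpansive _ (clip_is_projection k0)).
by move=> x y t; exact: (@ball_convex k).
Qed.

Lemma enorm_clip_le (k : R) u : 0 <= k -> enorm (clip k u) <= k.
Proof. by move=> k0; have [] := clip_is_projection k0 u. Qed.

(** Clipping at [k] captures length [k] of any longer vector. With [k = a t], the remainder is the
    distance that one step of steering leaves. *)
Lemma enorm_sub_clip (k c : R) u : 0 <= k -> 0 <= c -> enorm u <= c + k ->
  enorm (u - clip k u) <= c.
Proof.
move=> k0 c0 uck; rewrite /clip; have [u0|u0] := eqVneq (enorm u) 0.
  by rewrite subrr enorm0.
have up : 0 < enorm u by rewrite lt0r u0 enorm_ge0.
rewrite minEle; case: ifPn => [|]; first by rewrite scale1r subrr enorm0.
rewrite -ltNge ltr_pdivrMr// mul1r => uk.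
rewrite -[X in X - _]scale1r -scalerBl enormZ ger0_norm; last first.
  by rewrite subr_ge0 ler_pdivrMr// mul1r ltW.
rewrite mulrBl divfK// mul1r; lra.
Qed.

End Euclidean.

(** * Gaussian translation *)

Section integral_transfer.
Local Open Scope ereal_scope.
Import HBNNSimple.
Context (R : realType) (d d' : measure_display).
Context (T : measurableType d) (E : measurableType d').
Variables (m : {measure set T -> \bar R}) (U : T -> R) (Z : T -> E).
Hypotheses (mU : measurable_fun setT U) (U0 : forall x, (0 <= U x)%R).
Hypothesis mZ : measurable_fun setT Z.

Lemma integral_weighted_nnsfun (h : {nnsfun E >-> R}) :
  \int[m]_x ((U x)%:E * (h (Z x))%:E) =
  \sum_(r \in range h) r%:E * \int[m]_x (U x * \1_(h @^-1` [set r]) (Z x))%:E.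
Proof.
have mi r : measurable_fun setT
    (fun x => (U x * \1_(h @^-1` [set r]) (Z x))%R).
  apply: measurable_funM => //.
  have mi : measurable_fun setT (\1_(h @^-1` [set r]) : E -> R) by [].
  exact: measurableT_comp mi mZ.
transitivity (\int[m]_x (\sum_(r \in range h)
    (r * (U x * \1_(h @^-1` [set r]) (Z x)))%:E)).
  apply: eq_integral => x _; rewrite -EFinM fsumEFin// [in LHS]fimfunE.
  rewrite !fsbig_finite//= mulr_sumr; congr EFin.
  by apply: eq_bigr => r _; rewrite mulrCA.
have r0 r x : 0 <= (r * (U x * \1_(h @^-1` [set r]) (Z x)))%:E.
  rewrite lee_fin mulrCA mulr_ge0//; have := nnfun_muleindic_ge0 h r (Z x).
  by rewrite -EFinM lee_fin.
rewrite ge0_integral_fsum//; last first.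
  by move=> r; apply/measurable_EFinP/measurable_funM.
rewrite !fsbig_finite//=; apply: eq_big_seq => r.
rewrite in_fset_set// inE => -[t _ tr].
under eq_integral do rewrite EFinM.
rewrite ge0_integralZl//; first exact/measurable_EFinP.
- by move=> x _; rewrite lee_fin mulr_ge0.
- by rewrite lee_fin -tr.
Qed.

Lemma integral_weighted_approx (f : E -> \bar R)
    (mf : measurable_fun setT f) : (forall y, 0 <= f y) ->
  \int[m]_x ((U x)%:E * f (Z x)) =
  limn (fun n => \int[m]_x ((U x)%:E * (nnsfun_approx measurableT mf n (Z x))%:E)).
Proof.
move=> f0; set h := nnsfun_approx _ _.
rewrite -monotone_convergence//.
- apply: eq_integral => x _; apply/esym/cvg_lim => //.
  apply: cvgeZl => //.
  by apply: (cvg_nnsfun_approx measurableT mf (fun y _ => f0 y)).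
- move=> n; apply/measurable_EFinP/measurable_funM => //.
  exact: measurableT_comp.
- by move=> n x _; rewrite -EFinM lee_fin mulr_ge0.
- move=> x _ a b ab; rewrite -!EFinM lee_fin ler_wpM2l//.
  exact/lefP/nd_nnsfun_approx.
Qed.

End integral_transfer.

Section eq_integral_weighted.
Import HBNNSimple.

(** Both sides are limits along the same simple approximations of [f], so agreement on indicators
    suffices. It is applied to the Gaussian density, to translations of Lebesgue measure, and to the
    exchange of [f (Z')] with [M] in the moment bound. *)
Lemma eq_integral_weighted (R : realType) (d1 d2 d' : measure_display)
    (T1 : measurableType d1) (T2 : measurableType d2) (E : measurableType d')
    (m1 : {measure set T1 -> \bar R}) (m2 : {measure set T2 -> \bar R})
    (U1 : T1 -> R) (U2 : T2 -> R) (Z1 : T1 -> E) (Z2 : T2 -> E) :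
  measurable_fun setT U1 -> (forall x, 0 <= U1 x) -> measurable_fun setT Z1 ->
  measurable_fun setT U2 -> (forall x, 0 <= U2 x) -> measurable_fun setT Z2 ->
  (forall A, measurable A -> (\int[m1]_x (U1 x * \1_A (Z1 x))%:E =
                              \int[m2]_x (U2 x * \1_A (Z2 x))%:E)%E) ->
  forall f : E -> \bar R, measurable_fun setT f -> (forall y, (0 <= f y)%E) ->
  (\int[m1]_x ((U1 x)%:E * f (Z1 x)) = \int[m2]_x ((U2 x)%:E * f (Z2 x)))%E.
Proof.
move=> mU1 U10 mZ1 mU2 U20 mZ2 H f mf f0.
rewrite !(integral_weighted_approx _ _ _ _ mf)//.
congr (limn _); apply/funext => n; rewrite !integral_weighted_nnsfun//.
by apply: eq_fsbigr => r _; rewrite H.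
Qed.

End eq_integral_weighted.

(** * Change of variables for a single Gaussian coordinate *)

Section gaussian_shift.
Variables (R : realType) (sigma : R).
Hypothesis sigma0 : 0 < sigma.
Notation leb := (@lebesgue_measure R).
Notation gauss := (@normal_prob R 0 sigma).
Notation pdf := (@normal_pdf R 0 sigma).

Lemma integral_normal_prob (f : R -> \bar R) :
  measurable_fun setT f -> (forall y, (0 <= f y)%E) ->
  (\int[gauss]_x f x = \int[leb]_x ((pdf x)%:E * f x))%E.
Proof.
move=> mf f0.
transitivity (\int[gauss]_x (1%:E * f x))%E.
  by apply: eq_integral => x _; rewrite mul1e.
apply: (@eq_integral_weighted R _ _ _ _ _ _ gauss leb (fun=> 1) pdf id id) => //.
- exact: measurable_normal_pdf.
- exact: normal_pdf_ge0.
- move=> A mA; under eq_integral do rewrite mul1r.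
  rewrite integral_indic// setIT.
  transitivity (\int[leb]_(x in A) (pdf x)%:E)%E => //.
  rewrite [LHS]integral_mkcond.
  by apply: eq_integral => x _; rewrite epatch_indic EFinM.
Qed.

(** Lebesgue measure is determined by its values on half-open intervals, whose lengths a translation
    preserves. *)
Lemma lebesgue_measure_shift (s : R) (A : set R) : measurable A ->
  leb (center s @^-1` A) = leb A.
Proof.
move=> mA.
have ms : measurable_fun setT (center s : measurableTypeR R -> measurableTypeR R).
  exact: measurable_funB.
pose cs : {mfun measurableTypeR R >-> measurableTypeR R} :=
  HB.pack (center s) (isMeasurableFun.Build _ _ _ _ _ ms).
apply/esym; apply: (@lebesgue_measure_unique R (pushforward leb cs)) => // X.
case=> -[a b] /= ab <-; rewrite /pushforward.
have -> : cs @^-1` `]a, b]%classic = `]a + s, b + s]%classic.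
  by apply/seteqP; split=> x /=; rewrite !in_itv/= ltrBrDr lerBlDr.
by rewrite !lebesgue_measure_itv/= !lte_fin ltrD2r -!EFinB; case: ifP => // _; congr EFin; ring.
Qed.

Lemma integral_lebesgue_shift (s : R) (f : R -> \bar R) :
  measurable_fun setT f -> (forall y, (0 <= f y)%E) ->
  (\int[leb]_x f (x - s)%R = \int[leb]_x f x)%E.
Proof.
move=> mf f0.
transitivity (\int[leb]_x (1%:E * f (center s x)))%E.
  by apply: eq_integral => x _; rewrite mul1e.
transitivity (\int[leb]_x (1%:E * f x))%E; last first.
  by apply: eq_integral => x _; rewrite mul1e.
apply: (@eq_integral_weighted R _ _ _ _ _ _ leb leb (fun=> 1) (fun=> 1) (center s) id) => //.
- exact: measurable_funB.
- move=> A mA; under eq_integral do rewrite mul1r.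
  under [RHS]eq_integral do rewrite mul1r.
  transitivity (leb (center s @^-1` A)); last first.
    by rewrite lebesgue_measure_shift// integral_indic// setIT.
  transitivity (\int[leb]_x (\1_(center s @^-1` A) x)%:E)%E => //.
  rewrite integral_indic ?setIT//.
  by rewrite -[X in measurable X]setTI; apply: measurable_funB.
Qed.

(** Completing the square: the exponential factor turns the density at [x] into the density at
    [x - s], and Lebesgue measure ignores the translation. This is Girsanov's formula for one
    coordinate and a constant shift. *)
Lemma integral_gaussian_shift (s : R) (f : R -> \bar R) :
  measurable_fun setT f -> (forall y, (0 <= f y)%E) ->
  (\int[gauss]_x ((expR (s * x / sigma ^+ 2 - s ^+ 2 / (2 * sigma ^+ 2)))%:E
                  * f (x - s)%R) = \int[gauss]_x f x)%E.
Proof.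
move=> mf f0.
have mfs : measurable_fun setT (fun x : R => f (x - s)).
  by apply: measurableT_comp => //; exact: measurable_funB.
rewrite !integral_normal_prob//; last 2 first.
- apply: emeasurable_funM => //; apply/measurable_EFinP/measurableT_comp => //.
  apply: measurable_funB => //; apply: measurable_funM => //.
- by move=> y; rewrite mule_ge0// lee_fin expR_ge0.
rewrite -[RHS](integral_lebesgue_shift s) => [|| y]; last 2 first.
- apply: emeasurable_funM => //; apply/measurable_EFinP.
  exact: measurable_normal_pdf.
- by rewrite mule_ge0// lee_fin normal_pdf_ge0.
apply: eq_integral => x _; rewrite muleA -EFinM; congr (_%:E * _)%E.
have s0 : sigma != 0 by rewrite gt_eqF.
rewrite !normal_pdfE// -[LHS]mulrA; congr (_ * _); rewrite /normal_fun -expRD.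
by congr expR; field.
Qed.

End gaussian_shift.

(** * Girsanov's formula *)

Section tuples.
Context (R : realType) (N : nat).
Notation E := (N.-tuple R).

Definition mktup (f : nat -> R) : E := [tuple f i | i < N].

Lemma nth_mktup f j : (j < N)%N -> (mktup f)`_j = f j.
Proof.
by move=> jN; rewrite -[j]/(nat_of_ord (Ordinal jN)) -tnth_nth tnth_mktuple.
Qed.

Lemma eq_tup (y z : E) : (forall j, (j < N)%N -> y`_j = z`_j) -> y = z.
Proof. by move=> H; apply: eq_from_tnth => i; rewrite !(tnth_nth 0) H. Qed.

Lemma measurable_mktup d (T : measurableType d) (f : nat -> T -> R) :
  (forall i, measurable_fun setT (f i)) ->
  measurable_fun setT (fun x => mktup (f ^~ x)).
Proof.
move=> mf; apply/measurable_fun_tnthP => i; rewrite (_ : _ \o _ = f i)//.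
by apply/funext => x /=; rewrite tnth_mktuple.
Qed.

Lemma measurable_nth (j : nat) : measurable_fun setT (fun y : E => y`_j).
Proof.
have [jN|Nj] := ltnP j N.
  rewrite (_ : (fun _ => _) = (@tnth _ R)^~ (Ordinal jN)).
    exact: measurable_tnth.
  by apply/funext => y; rewrite (tnth_nth 0).
rewrite (_ : (fun _ => _) = cst 0)//.
by apply/funext => y; rewrite nth_default// size_tuple.
Qed.

(** A pi-system from which Dynkin induction can start. The sides are indexed by naturals to match
    the independence hypothesis [X_indep]. *)
Definition rectangles : set (set E) :=
  [set A | exists2 C : nat -> set R, (forall i, measurable (C i)) &
     A = [set y : E | forall i, (i < N)%N -> C i y`_i]].

Lemma rectangles_setI : setI_closed rectangles.
Proof.
move=> _ _ [C mC ->] [D mD ->]; exists (fun i => C i `&` D i).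
  by move=> i; exact: measurableI.
apply/seteqP; split=> y /=.
  by move=> [yC yD] i iN; split; [exact: yC|exact: yD].
by move=> H; split=> i /H[].
Qed.

Lemma measurable_rectangles : @measurable _ E = <<s rectangles >>.
Proof.
apply/seteqP; split.
- apply: smallest_sub; first exact: smallest_sigma_algebra.
  move=> A; rewrite -bigcup_seq/= => -[i _ [B mB <-]].
  apply: sub_sigma_algebra; exists (fun j : nat => if j == i :> nat then B else setT).
    by move=> j; case: ifP.
  rewrite setTI; apply/seteqP; split => y /=; rewrite (tnth_nth 0).
    by move=> yB j jN; case: eqP => // ->.
  by move/(_ i (ltn_ord i)); rewrite eqxx.
- apply: smallest_sub; first exact: sigma_algebra_measurable.
  move=> _ [C mC ->].
  rewrite (_ : [set _ | _] = \bigcap_i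
      (if (i < N)%N then (fun y : E => y`_i) @^-1` C i else setT)).
    apply: bigcapT_measurable => i; case: ifP => // _.
    by rewrite -[X in measurable X]setTI; exact: measurable_nth.
  apply/seteqP; split=> y /=; first by move=> H i _; case: ifP => // /H.
  by move=> H i iN; have := H i I; rewrite iN.
Qed.

End tuples.

Section girsanov.
Context (R : realType) (sigma : R) (d : measure_display).
Context (Omega : measurableType d) (P : probability Omega R) (N : nat).
Variable X : nat -> Omega -> R.
Notation E := (N.-tuple R).
Notation gauss := (@normal_prob R 0 sigma).
Hypothesis sigma0 : 0 < sigma.
Hypothesis mX : forall j, measurable_fun setT (X j).
Hypothesis X_gauss : forall j, (j < N)%N -> forall A, measurable A ->
  P (X j @^-1` A) = gauss A.
Hypothesis X_indep : forall k, (k <= N)%N -> forall A : nat -> set R,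
  (forall j, measurable (A j)) ->
  P (\big[setI/setT]_(j < k) (X j @^-1` A j)) =
  (\prod_(j < k) P (X j @^-1` A j))%E.

(** Padding with zeros keeps the histories of all times in one type, so that shifts and test
    functions need no dependent length. *)
Definition hist k (w : Omega) : E := mktup N (fun i => if (i < k)%N then X i w else 0).

Lemma measurable_hist k : measurable_fun setT (hist k).
Proof.
apply: (measurable_mktup (f := fun i w => if (i < k)%N then X i w else 0)) => i.
by case: (i < k)%N.
Qed.

(** Independence is assumed on product sets only; Dynkin induction on [A] extends it to all events
    of the past. *)
Lemma hist_indep k A B : (k < N)%N -> measurable A -> measurable B ->
  P (hist k @^-1` A `&` X k @^-1` B) = (P (hist k @^-1` A) * gauss B)%E.
Proof.
move=> kN mA mB.
have mh S : measurable S -> measurable (hist k @^-1` S).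
  by move=> mS; have := measurable_hist k measurableT mS; rewrite setTI.
have mXB : measurable (X k @^-1` B).
  by have := @mX k measurableT _ mB; rewrite setTI.
pose Q (S : set E) :=
  P (hist k @^-1` S `&` X k @^-1` B) = (P (hist k @^-1` S) * gauss B)%E.
apply: (@dynkin_induction _ E (@rectangles R N) Q).
- exact: measurable_rectangles.
- exact: rectangles_setI.
- by rewrite /Q preimage_setT setTI X_gauss// probability_setT mul1e.
- move=> _ [C mC ->]; rewrite /Q.
  (* The padded coordinates of [hist k] are 0: if a side [C i] with [k <= i] misses 0 the preimage
     is empty, otherwise only the sides below [k] matter. *)
  have [C0|] := pselect (forall i, (k <= i < N)%N -> C i 0); last first.
    move=> C0; rewrite (_ : _ @^-1` _ = set0); first by rewrite set0I measure0 mul0e.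
    apply/seteqP; split => // w H; apply: C0 => i /andP[ki iN].
    by have := H i iN; rewrite /hist nth_mktup// ltnNge ki.
  have -> : hist k @^-1` [set y : E | forall i, (i < N)%N -> C i y`_i] =
      \big[setI/setT]_(j < k) (X j @^-1` C j).
    rewrite -(bigcap_mkord k (fun j => X j @^-1` C j)); apply/seteqP; split => w.
      move=> H i ik; have iN := ltn_trans ik kN; have := H i iN.
      by rewrite /hist nth_mktup// (_ : (i < k)%N = true).
    move=> H i iN; rewrite /hist nth_mktup//; case: ltnP => ik; first exact: (H i ik).
    by apply: C0; rewrite ik.
  (* With [B] as the side at [k], the joint event is again a product set, over [k.+1]
     coordinates. *)
  pose D j := if j == k then B else C j.
  have mD j : measurable (D j) by rewrite /D; case: ifP.
  have Dk (j : 'I_k) : D j = C j by rewrite /D ltn_eqF.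
  have := X_indep kN mD; rewrite !big_ord_recr/=.
  under eq_bigr do rewrite Dk.
  under [in RHS]eq_bigr do rewrite Dk.
  by rewrite -X_indep ?(ltnW kN)// {1 2}/D eqxx X_gauss.
- move=> S mS; rewrite /Q => QS.
  rewrite (_ : hist k @^-1` (~` S) = ~` (hist k @^-1` S))// setIC -setDE.
  have fin Y : measurable Y -> P Y \is a fin_num by exact: fin_num_measure.
  rewrite measureD// ?setIid; [|exact: mh|by rewrite ltey_eq fin].
  have QS' : P (X k @^-1` B `&` hist k @^-1` S) = (P (hist k @^-1` S) * gauss B)%E.
    by rewrite setIC.
  rewrite [Y in (_ - Y)%E]QS' probability_setC; last exact: mh.
  have XB : P (X k @^-1` B) = gauss B := X_gauss kN mB.
  rewrite [Y in (Y - _)%E]XB muleBl ?mul1e//; first by rewrite -XB fin.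
- move=> F mF tF QF; rewrite /Q !preimage_bigcup setI_bigcupl.
  have tF1 : trivIset setT (fun i => hist k @^-1` F i).
    apply/trivIsetP => i j _ _ ij; rewrite -preimage_setI.
    by move/trivIsetP : tF => ->//; rewrite preimage_set0.
  have tF2 : trivIset setT (fun i => hist k @^-1` F i `&` X k @^-1` B).
    exact: trivIset_setIr.
  rewrite !measure_bigcup//; last 2 first.
    by move=> i _; apply: mh.
    by move=> i _; apply: measurableI => //; exact: mh.
  have gB : gauss B \is a fin_num by exact: fin_num_measure.
  rewrite muleC -(fineK gB) -nneseriesZl; last by move=> i _; exact: measure_ge0.
  by apply: eq_eseriesr => i _; rewrite fineK// muleC; exact: QF.
- by rewrite -measurable_rectangles.
Qed.

(** By [hist_indep] the joint law of past and present is a product measure, so Tonelli's theorem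
    applies. *)
Lemma integral_hist k (f : E * measurableTypeR R -> \bar R) : (k < N)%N ->
  measurable_fun setT f -> (forall y, (0 <= f y)%E) ->
  (\int[P]_w f (hist k w, X k w) =
   \int[P]_w \int[gauss]_x f (hist k w, x))%E.
Proof.
move=> kN mf f0.
have mh : measurable_fun setT (hist k) := measurable_hist k.
have mhx : measurable_fun setT
    (fun w => (hist k w, X k w) : E * measurableTypeR R).
  by apply: measurable_fun_pair => //; exact: mX.
pose h : {RV P >-> E} := HB.pack (hist k) (isMeasurableFun.Build _ _ _ _ _ mh).
pose hx : {RV P >-> (E * measurableTypeR R)%type} := HB.pack (fun w => (hist k w, X k w))
  (isMeasurableFun.Build _ _ _ _ _ mhx).
transitivity (\int[distribution P hx]_y f y)%E.
  by rewrite ge0_integral_distribution.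
transitivity (\int[distribution P h \x gauss]_y f y)%E.
  apply: eq_measure_integral => S mS _; apply/esym.
  apply: product_measure_unique => // A B mA mB.
  exact: hist_indep.
rewrite fubini_tonelli1// ge0_integral_distribution//.
- exact: measurable_fun_fubini_tonelli_F.
- by move=> y; exact: integral_ge0.
Qed.

Variable s : nat -> E -> R.
Hypothesis ms : forall j, measurable_fun setT (s j).
Hypothesis s_adapted : forall j (y z : E),
  (forall i, (i < j)%N -> y`_i = z`_i) -> s j y = s j z.

(** Logarithm of the exponential martingale attached to the predictable shift [s]. *)
Definition log_weight k (y : E) : R :=
  \sum_(j < k) (s j y * y`_j / sigma ^+ 2 - s j y ^+ 2 / (2 * sigma ^+ 2)).

(** Entries from [k] on are zeroed as in [hist k], which lets the induction on [k] compare functions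
    of the first [k] coordinates only. *)
Definition unshift k (y : E) : E :=
  mktup N (fun i => if (i < k)%N then y`_i - s i y else 0).

Definition setcoord k (y : E) (x : R) : E :=
  mktup N (fun i => if i == k then x else y`_i).

Lemma measurable_log_weight k : measurable_fun setT (log_weight k).
Proof.
apply: measurable_sum => j; apply: measurable_funB.
  by apply: measurable_funM => //; apply: measurable_funM => //; exact: measurable_nth.
by apply: measurable_funM => //; exact: measurable_funX.
Qed.

Lemma measurable_unshift k : measurable_fun setT (unshift k).
Proof.
apply: (measurable_mktup (f := fun i (y : E) => if (i < k)%N then y`_i - s i y else 0)) => i.
by case: (i < k)%N => //; apply: measurable_funB => //; exact: measurable_nth.
Qed.

Lemma measurable_setcoord k :
  measurable_fun setT (fun yx : E * measurableTypeR R => setcoord k yx.1 yx.2).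
Proof.
apply: (measurable_mktup (f := fun i (yx : E * measurableTypeR R) => if i == k then (yx.2 : R) else yx.1`_i)) => i.
case: (i == k); first exact: measurable_snd.
exact: (measurableT_comp (measurable_nth _) measurable_fst).
Qed.

Lemma histS k w : hist k.+1 w = setcoord k (hist k w) (X k w).
Proof.
apply: eq_tup => j jN; rewrite !nth_mktup// ltnS leq_eqVlt.
by case: eqP => //= ->.
Qed.

Lemma nth_setcoord k y x i : (i < N)%N ->
  (setcoord k y x)`_i = if i == k then x else y`_i.
Proof. by move=> iN; rewrite nth_mktup. Qed.

Lemma s_setcoord k j y x : (k < N)%N -> (j <= k)%N ->
  s j (setcoord k y x) = s j y.
Proof.
move=> kN jk; apply: s_adapted => i ij.
have ik := leq_trans ij jk.
by rewrite nth_setcoord ?(ltn_trans ik)// ltn_eqF.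
Qed.

Lemma log_weightS k y x : (k < N)%N ->
  log_weight k.+1 (setcoord k y x) =
  log_weight k y + (s k y * x / sigma ^+ 2 - s k y ^+ 2 / (2 * sigma ^+ 2)).
Proof.
move=> kN; rewrite /log_weight big_ord_recr/= s_setcoord// nth_setcoord// eqxx.
congr (_ + _); apply: eq_bigr => j _.
rewrite s_setcoord ?(ltnW (ltn_ord j))//.
by rewrite nth_setcoord ?(ltn_trans (ltn_ord j))// ltn_eqF.
Qed.

Lemma unshiftS k y x : (k < N)%N ->
  unshift k.+1 (setcoord k y x) = setcoord k (unshift k y) (x - s k y).
Proof.
move=> kN; apply: eq_tup => j jN; rewrite !nth_mktup// ltnS.
case: ltngtP => // [jk|->]; last by rewrite s_setcoord.
by rewrite s_setcoord ?(ltnW jk).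
Qed.

(** Induction on the number of coordinates. Given the past, [s k] is a constant, so integrating out
    coordinate [k] is an instance of the one-dimensional formula. *)
Lemma girsanov_hist k (f : E -> \bar R) : (k <= N)%N ->
  measurable_fun setT f -> (forall y, (0 <= f y)%E) ->
  (\int[P]_w ((expR (log_weight k (hist k w)))%:E * f (unshift k (hist k w)))
   = \int[P]_w f (hist k w))%E.
Proof.
elim: k f => [|k IH] f kN mf f0.
  apply: eq_integral => w _; rewrite /log_weight big_ord0 expR0 mul1e.
  by congr f; apply: eq_tup => i iN; rewrite !nth_mktup.
(* The induction hypothesis is used for [f] averaged over the newest coordinate, which is why [f]
   was generalised. *)
pose g (y : E) := (\int[gauss]_x f (setcoord k y x))%E.
have mfs : measurable_fun setT (fun yx : E * measurableTypeR R => f (setcoord k yx.1 yx.2)).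
  exact: (measurableT_comp mf (measurable_setcoord k)).
have mg : measurable_fun setT g.
  apply: (@measurable_fun_fubini_tonelli_F _ _ _ _ R gauss
    (fun yx : E * measurableTypeR R => f (setcoord k yx.1 yx.2))) => // yx.
have g0 y : (0 <= g y)%E by exact: integral_ge0.
transitivity (\int[P]_w g (hist k w))%E; last first.
  rewrite -(integral_hist kN mfs)//.
  by apply: eq_integral => w _; rewrite histS.
rewrite -(IH _ (ltnW kN) mg g0).
pose F (yx : E * measurableTypeR R) := ((expR (log_weight k.+1 (setcoord k yx.1 yx.2)))%:E *
  f (unshift k.+1 (setcoord k yx.1 yx.2)))%E.
have mF : measurable_fun setT F.
  apply: emeasurable_funM.
    apply/measurable_EFinP/measurableT_comp => //.
    exact: (measurableT_comp (measurable_log_weight k.+1) (measurable_setcoord k)).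
  apply: (measurableT_comp mf).
  exact: (measurableT_comp (measurable_unshift k.+1) (measurable_setcoord k)).
have F0 yx : (0 <= F yx)%E by rewrite mule_ge0// lee_fin expR_ge0.
under eq_integral do rewrite histS.
rewrite (integral_hist kN mF F0).
apply: eq_integral => w _; rewrite /F/=; set y := hist k w.
under eq_integral do rewrite log_weightS// unshiftS// expRD EFinM -muleA.
have mfu : measurable_fun setT (fun x => f (setcoord k (unshift k y) x)).
  exact: (measurableT_comp mfs (measurable_pair1 _)).
rewrite ge0_integralZl//; last 2 first.
- apply: emeasurable_funM.
    apply/measurable_EFinP/measurableT_comp => //.
    by apply: measurable_funB => //; apply: measurable_funM => //.
  apply: (measurableT_comp mfu); exact: measurable_funB.
- by move=> x _; rewrite mule_ge0// lee_fin expR_ge0.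
congr (_ * _)%E.
by rewrite (integral_gaussian_shift sigma0 (s k y) (f := fun x => f (setcoord k (unshift k y) x))).
Qed.

End girsanov.

(** * Renyi divergence of reweighted laws *)

(** Young's inequality for the conjugate exponents [alpha] and [alpha / (alpha - 1)], cleared of
    denominators. *)
Lemma young_powR (R : realType) (alpha m x : R) : 1 < alpha -> 0 <= m -> 0 <= x ->
  alpha * (m * x `^ (alpha - 1)) <= m `^ alpha + (alpha - 1) * x `^ alpha.
Proof.
move=> a1 m0 x0.
have a0 : 0 < alpha by rewrite (lt_trans ltr01).
have am1 : 0 < alpha - 1 by rewrite subr_gt0.
have am0 : alpha - 1 != 0 by rewrite gt_eqF.
have an0 : alpha != 0 by rewrite gt_eqF.
have := @conjugate_powR R m (x `^ (alpha - 1)) alpha (alpha / (alpha - 1)) m0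
  (powR_ge0 _ _) a0 (divr_gt0 a0 am1).
have -> : alpha^-1 + (alpha / (alpha - 1))^-1 = 1 by field; rewrite am0 an0.
rewrite -powRrM mulrCA divff// mulr1 => /(_ erefl).
rewrite -(ler_pM2l a0) => /le_trans; apply.
by rewrite mulrDr mulrCA divff// mulr1 lerD2l invf_div mulrCA [alpha * _]mulrCA divff// mulr1 mulrC.
Qed.

Section renyi_bound.
Context (R : realType) (d d' : measure_display).
Context (Omega : measurableType d) (P : probability Omega R).
Context (E : measurableType d').
Variables (Z Z' : Omega -> E) (M : Omega -> R).
Hypotheses (mZ : measurable_fun setT Z) (mZ' : measurable_fun setT Z').
Hypotheses (mM : measurable_fun setT M) (M0 : forall w, 0 <= M w).
Hypothesis ZM : forall A, measurable A ->
  P (Z @^-1` A) = (\int[P]_w (M w * \1_A (Z' w))%:E)%E.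

(** By [ZM], a null set for the law of [Z'] is null for the law of [Z], so Radon-Nikodym applies.
    This rules out the branch in which [renyi] is [+oo]. *)
Lemma density_exists : exists f, is_density (pushforward P Z) (pushforward P Z') f.
Proof.
pose X : {RV P >-> E} := HB.pack Z (isMeasurableFun.Build _ _ _ _ _ mZ).
pose X' : {RV P >-> E} := HB.pack Z' (isMeasurableFun.Build _ _ _ _ _ mZ').
have dom : distribution P X `<< distribution P X'.
  apply/null_content_dominatesP => A mA A0.
  have mZA : measurable (Z' @^-1` A).
    by have := mZ' measurableT mA; rewrite setTI.
  transitivity (\int[P]_w (M w * \1_A (Z' w))%:E)%E; first exact: ZM.
  transitivity (\int[P]_(w in Z' @^-1` A) (M w)%:E)%E.
    rewrite [RHS]integral_mkcond; apply: eq_integral => w _.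
    by rewrite epatch_indic EFinM.
  apply: null_set_integral => //.
  by apply: measurable_funTS; exact/measurable_EFinP.
pose g := Radon_Nikodym_SigmaFinite.f (distribution P X) (distribution P X').
have g0 : forall x, (0 <= g x)%E := Radon_Nikodym_SigmaFinite.f_ge0 dom.
have gfin : forall x, g x \is a fin_num := Radon_Nikodym_SigmaFinite.f_fin_num dom.
have gi := Radon_Nikodym_SigmaFinite.f_integrable dom.
exists (fine \o g); split; last split.
- apply/measurable_EFinP; rewrite (_ : _ \o _ = g); first exact: measurable_int gi.
  by apply/funext => x; rewrite /= fineK.
- by move=> x; rewrite /= fine_ge0.
- move=> A mA.
  transitivity (\int[distribution P X']_(x in A) g x)%E.
    exact: (Radon_Nikodym_SigmaFinite.f_integral dom).
  by apply: eq_integral => x _; rewrite /= fineK.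
Qed.

Variable alpha : R.
Hypothesis alpha1 : 1 < alpha.

(** As [f (Z')] is the conditional expectation of [M] given [Z'], this is conditional Jensen.
    Trading one factor [f (Z')] for [M] and applying Young gives [alpha * I <= E(M^alpha) + (alpha -
    1) * I] with [I = E(f (Z')^alpha)]; the term on the right is then absorbed, provided [I] is
    finite. *)
Lemma density_moment_le f : is_density (pushforward P Z) (pushforward P Z') f ->
  (\int[pushforward P Z']_x (f x `^ alpha)%:E <= \int[P]_w (M w `^ alpha)%:E)%E.
Proof.
move=> [mf [f0 fA]].
pose X' : {RV P >-> E} := HB.pack Z' (isMeasurableFun.Build _ _ _ _ _ mZ').
have mfZ : measurable_fun setT (f \o Z') by exact: measurableT_comp.
have a0 : 0 < alpha by rewrite (lt_trans ltr01).
have am1 : 0 <= alpha - 1 by rewrite subr_ge0 ltW.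
have mpow r (h : Omega -> R) : measurable_fun setT h ->
    measurable_fun setT (fun w => h w `^ r).
  by move=> mh; exact: (measurableT_comp (measurable_powR r) mh).
have mpowE r : measurable_fun setT (fun x => f x `^ r).
  exact: (measurableT_comp (measurable_powR r) mf).
(* Against functions of [Z'], the weights [M] and [f (Z')] integrate alike. *)
have H g : measurable_fun setT g -> (forall y, (0 <= g y)%E) ->
    (\int[P]_w ((M w)%:E * g (Z' w)) = \int[P]_w ((f (Z' w))%:E * g (Z' w)))%E.
  apply: eq_integral_weighted => // A mA; rewrite -ZM//.
  transitivity (pushforward P Z A) => //; rewrite fA// [LHS]integral_mkcond.
  transitivity (\int[distribution P X']_x (f x * \1_A x)%:E)%E.
    by apply: eq_integral => x _; rewrite epatch_indic EFinM.
  rewrite ge0_integral_distribution//.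
  - by apply/measurable_EFinP/measurable_funM.
  - by move=> y; rewrite lee_fin mulr_ge0// indicE ler0n.
(* Truncating at [f <= n] makes the moment finite, so that it can be subtracted; monotone
   convergence removes the truncation. *)
pose S n := [set x | f x <= n%:R].
have mS n : measurable (S n).
  have -> : S n = f @^-1` `]-oo, n%:R]%classic.
    by apply/seteqP; split=> x /=; rewrite in_itv.
  by rewrite -[X in measurable X]setTI; exact: mf.
pose I n := (\int[P]_w (f (Z' w) `^ alpha * \1_(S n) (Z' w))%:E)%E.
have mSZ n : measurable_fun setT (fun w => \1_(S n) (Z' w) : R).
  have mi : measurable_fun setT (\1_(S n) : E -> R) by exact: measurable_indic.
  exact: measurableT_comp mi mZ'.
have S01 n y : 0 <= \1_(S n) y :> R by rewrite indicE ler0n.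
have ISn n : (I n <= \int[P]_w (M w `^ alpha)%:E)%E.
  have IE : I n = (\int[P]_w (M w * (f (Z' w) `^ (alpha - 1) * \1_(S n) (Z' w)))%:E)%E.
    transitivity (\int[P]_w ((f (Z' w))%:E *
       (f (Z' w) `^ (alpha - 1) * \1_(S n) (Z' w))%:E))%E.
      by apply: eq_integral => w _; rewrite -EFinM mulrA mulr_powRB1.
    rewrite -(H (fun y => (f y `^ (alpha - 1) * \1_(S n) y)%:E)%E).
    - by apply: eq_integral => w _; rewrite EFinM.
    - by apply/measurable_EFinP/measurable_funM.
    - by move=> y; rewrite lee_fin mulr_ge0// powR_ge0.
  have Ifin : I n \is a fin_num.
    rewrite ge0_fin_numE; last first.
      by apply: integral_ge0 => w _; rewrite lee_fin mulr_ge0 ?powR_ge0.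
    apply: (@le_lt_trans _ _ (\int[P]_w (n%:R `^ alpha)%:E)%E); last first.
      by rewrite integral_cst//= probability_setT mule1 ltry.
    apply: ge0_le_integral => //.
    - by move=> w _; rewrite lee_fin mulr_ge0 ?powR_ge0.
    - by apply/measurable_EFinP/measurable_funM => //; exact: mpow.
    - move=> w _; rewrite lee_fin indicE; case: (boolP (Z' w \in S n)) => [|_].
        rewrite inE /S/= mulr1 => fn.
        by rewrite ge0_ler_powR// ?nnegrE// ltW.
      by rewrite mulr0 powR_ge0.
  have : (alpha%:E * I n <= \int[P]_w (M w `^ alpha)%:E + (alpha - 1)%:E * I n)%E.
    have mJ : measurable_fun setT
        (fun w => (M w * (f (Z' w) `^ (alpha - 1) * \1_(S n) (Z' w)))%:E).
      apply/measurable_EFinP/measurable_funM => //.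
      by apply: measurable_funM => //; exact: mpow.
    have J0 w : [set: Omega] w ->
        (0 <= (M w * (f (Z' w) `^ (alpha - 1) * \1_(S n) (Z' w)))%:E)%E.
      by move=> _; rewrite lee_fin mulr_ge0// mulr_ge0 ?powR_ge0.
    have mI : measurable_fun setT
        (fun w => (f (Z' w) `^ alpha * \1_(S n) (Z' w))%:E).
      by apply/measurable_EFinP/measurable_funM => //; exact: mpow.
    have I0 w : [set: Omega] w ->
        (0 <= (f (Z' w) `^ alpha * \1_(S n) (Z' w))%:E)%E.
      by move=> _; rewrite lee_fin mulr_ge0 ?powR_ge0.
    have mMa : measurable_fun setT (fun w => (M w `^ alpha)%:E).
      by apply/measurable_EFinP; exact: mpow.
    have Ma0 w : [set: Omega] w -> (0 <= (M w `^ alpha)%:E)%E.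
      by rewrite lee_fin powR_ge0.
    have aE0 : (0 <= alpha%:E)%E by rewrite lee_fin ltW.
    have mI' := measurable_funeM (alpha - 1)%:E mI.
    have I0' w : [set: Omega] w ->
        (0 <= (alpha - 1)%:E * (f (Z' w) `^ alpha * \1_(S n) (Z' w))%:E)%E.
      by move=> wT; rewrite mule_ge0// I0.
    rewrite {1}IE -!ge0_integralZl// -ge0_integralD//.
    apply: ge0_le_integral => //.
    - by move=> w wT; rewrite mule_ge0// J0.
    - exact: measurable_funeM.
    - exact: emeasurable_funD.
    - move=> w _; rewrite -!EFinM -EFinD lee_fin indicE; case: (_ \in _).
        by rewrite !mulr1; exact: young_powR.
      by rewrite !mulr0 addr0 powR_ge0.
  rewrite -(fineK Ifin); move: (fine _) => r.
  case: (\int[P]_w _)%E => [q| |]; rewrite ?leey//.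
  by rewrite -!EFinM -EFinD !lee_fin; lra.
have -> : (\int[pushforward P Z']_x (f x `^ alpha)%:E = limn I)%E.
  transitivity (\int[distribution P X']_x (f x `^ alpha)%:E)%E => //.
  rewrite ge0_integral_distribution//; last 2 first.
  - exact/measurable_EFinP.
  - by move=> y; rewrite lee_fin powR_ge0.
  rewrite -monotone_convergence//.
  - apply: eq_integral => w _; apply/esym/cvg_lim => //=.
    apply: cvg_near_cst; near=> n.
    rewrite indicE mem_set ?mulr1//= /S/=.
    near: n; exists (Num.truncn (f (Z' w))).+1 => // n /= fn.
    by rewrite (le_trans (ltW (truncnS_gt _)))// ler_nat.
  - by move=> n; apply/measurable_EFinP/measurable_funM => //; exact: mpow.
  - by move=> n w _; rewrite lee_fin mulr_ge0 ?powR_ge0.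
  - move=> w _ a b ab; rewrite lee_fin ler_wpM2l ?powR_ge0// !indicE ler_nat.
    case: (boolP (_ \in S a)) => //; rewrite inE => fa.
    by rewrite mem_set//= /S/= (le_trans fa)// ler_nat.
apply: lime_le; last by apply: nearW => n; exact: ISn.
apply: ereal_nondecreasing_is_cvgn => a b ab; apply: ge0_le_integral => //.
- by move=> w _; rewrite lee_fin mulr_ge0 ?powR_ge0.
- by apply/measurable_EFinP/measurable_funM => //; exact: mpow.
- by apply/measurable_EFinP/measurable_funM => //; exact: mpow.
- move=> w _; rewrite lee_fin ler_wpM2l ?powR_ge0// !indicE ler_nat.
  case: (boolP (_ \in S a)) => //; rewrite inE => fa.
  by rewrite mem_set//= /S/= (le_trans fa)// ler_nat.
Unshelve. all: by end_near. Qed.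

Lemma renyi_le (c : R) :
  (\int[P]_w (M w `^ alpha)%:E <= (expR ((alpha - 1) * c))%:E)%E ->
  (renyi alpha (pushforward P Z) (pushforward P Z') <= c%:E)%E.
Proof.
move=> Mc; rewrite /renyi; case: pselect => [H|]; last by have := density_exists.
have := density_moment_le (projT2 (cid H)).
move/le_trans => /(_ _ Mc).
have a1 : 0 < alpha - 1 by rewrite subr_gt0.
case: (\int[_]_x _)%E => [r| |]//= rc.
  (* A nonpositive moment has logarithm [-oo] under [eln], and the bound is trivial. *)
  case: ifPn => r0; last by rewrite gt0_muleNy ?leNye// lte_fin invr_gt0.
  rewrite -EFinM lee_fin mulrC ler_pdivrMr// mulrC -ler_expR lnK//.
by rewrite gt0_muleNy ?leNye// lte_fin invr_gt0.
Qed.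

End renyi_bound.

(** * Coupled iterates *)

Section batches.
Variables (n b : nat) (batch : nat -> {set 'I_n}) (istar : 'I_n).
Notation B := (n %/ b)%N.
Hypothesis hbsize : forall (e : nat) (i : 'I_B), #|batch (e * B + i)%N| = b.
Hypothesis hbdisj : forall (e : nat) (i1 i2 : 'I_B), i1 != i2 ->
     forall j : 'I_n, j \in batch (e * B + i1)%N ->
       j \notin batch (e * B + i2)%N.
Hypothesis hbcover : forall (e : nat) (j : 'I_n),
     exists i : 'I_B, j \in batch (e * B + i)%N.
Notation tEs := (tE batch b istar).

Lemma epoch_gt0 : (0 < B)%N.
Proof. by have [i _] := hbcover 0 istar; apply: leq_ltn_trans (ltn_ord i). Qed.

Lemma card_batch t : #|batch t| = b.
Proof.
rewrite {1}(divn_eq t B).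
exact: (hbsize (t %/ B) (Ordinal (ltn_pmod t epoch_gt0))).
Qed.

(** Since the batches of an epoch cover every index, the [pick] in [tE] succeeds and its default
    value 0 never occurs. *)
Lemma tE_spec e : exists2 i : 'I_B, tEs e = (e * B + i)%N & istar \in batch (tEs e).
Proof.
rewrite /tE; case: pickP => [i /= iB|H] /=; first by exists i.
by have [i iB] := hbcover e istar; have := H i; rewrite /= iB.
Qed.

Lemma mem_batch_tE e : istar \in batch (tEs e).
Proof. by have [] := tE_spec e. Qed.

Lemma divn_tE e : (tEs e %/ B)%N = e.
Proof.
have [i -> _] := tE_spec e.
by rewrite divnMDl ?epoch_gt0// divn_small ?addn0.
Qed.

(** Disjointness within the epoch [t %/ B] leaves room for only one step that uses [istar]. *)
Lemma mem_batchE t : istar \in batch t -> t = tEs (t %/ B).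
Proof.
move=> tB; have [i ti Hi] := tE_spec (t %/ B).
pose j := Ordinal (ltn_pmod t epoch_gt0).
have tj : t = (t %/ B * B + j)%N by exact: divn_eq.
have [ij|ij] := eqVneq i j; first by rewrite ti ij -tj.
by rewrite ti in Hi; have := hbdisj ij Hi; rewrite -tj tB.
Qed.

Lemma notin_batch_lt_tE0 t : (t < tEs 0)%N -> istar \notin batch t.
Proof.
move=> t0; apply/negP => /mem_batchE tE; move: (t0).
have [i t0i _] := tE_spec 0.
have tB : (t < B)%N by rewrite (ltn_trans t0)// t0i mul0n add0n.
by move: tE; rewrite divn_small// => <-; rewrite ltnn.
Qed.

End batches.

(** * One-step expansion estimates and the steered pair of runs *)

Section steps.
Variables (R : realType) (d : nat).
Notation vec := 'rV[R]_d.
Variables (K : set vec) (proj : vec -> vec).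
Hypothesis Kconv : forall x y t, K x -> K y -> 0 <= t <= 1 -> K (x + t *: (y - x)).
Hypothesis hproj : is_projection K proj.
Variables (X : Type) (grad : X -> vec -> vec) (L lam : R).
Hypotheses (hL : 0 <= L) (lam0 : 0 < lam).
Hypothesis hHolder : forall (z : X) (w w' : vec), K w -> K w' ->
     enorm (grad z w - grad z w') <= L * enorm (w - w') `^ lam.
Variables (eta Kc : R).
Hypotheses (heta : 0 < eta) (hKc : 0 <= Kc).
Variables (n b : nat) (batch : nat -> {set 'I_n}) (istar : 'I_n).
Hypothesis card_batch : forall t, #|batch t| = b.
Hypothesis b0 : (0 < b)%N.
Variables (D D' : 'I_n -> X).
Hypothesis hadj : forall i, i != istar -> D i = D' i.

Definition gstep (data : 'I_n -> X) t (w : vec) : vec :=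
  w - eta *: (b%:R^-1 *: \sum_(i in batch t) clip Kc (grad (data i) w)).

Let b0R : 0 < b%:R :> R. Proof. by rewrite ltr0n. Qed.

(** Common source of the one-step estimates, which differ only in the bound [c i] allotted to each
    sample. *)
Lemma gstep_dist (d1 d2 : 'I_n -> X) t w w' (c : 'I_n -> R) :
  (forall i, i \in batch t ->
     enorm (clip Kc (grad (d1 i) w) - clip Kc (grad (d2 i) w')) <= c i) ->
  enorm (gstep d1 t w - gstep d2 t w') <=
    enorm (w - w') + eta * (b%:R^-1 * \sum_(i in batch t) c i).
Proof.
move=> H; rewrite /gstep.
set S1 := \sum_(i in _) _; set S2 := \sum_(i in _) clip _ (grad (d2 i) _).
have -> : w - eta *: (b%:R^-1 *: S1) - (w' - eta *: (b%:R^-1 *: S2)) =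
    (w - w') - eta *: (b%:R^-1 *: (S1 - S2)).
  by rewrite !scalerBr !opprD !opprK addrACA.
rewrite (le_trans (enormD _ _))// lerD2l enormN !enormZ !gtr0_norm ?invr_gt0//.
rewrite ler_pM2l// ler_pM2l ?invr_gt0// -sumrB (le_trans (enorm_sum _ _ _))//.
exact: ler_sum.
Qed.

Lemma clip_diff_le2 (u v : vec) : enorm (clip Kc u - clip Kc v) <= 2 * Kc.
Proof.
rewrite (le_trans (enormD _ _))// enormN mulrDl !mul1r lerD//.
all: exact: enorm_clip_le.
Qed.

Lemma clip_grad_Holder z w w' : K w -> K w' ->
  enorm (clip Kc (grad z w) - clip Kc (grad z w')) <= L * enorm (w - w') `^ lam.
Proof.
by move=> Kw Kw'; rewrite (le_trans (clip_nonexpansive _ _ hKc))// hHolder.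
Qed.

Lemma gstep_dist_clip d1 d2 t w w' :
  enorm (gstep d1 t w - gstep d2 t w') <= enorm (w - w') + 2 * eta * Kc.
Proof.
rewrite (le_trans (gstep_dist (c := fun=> 2 * Kc) _))//.
  by move=> i _; exact: clip_diff_le2.
rewrite sumr_const card_batch -[(2 * Kc) *+ b]mulr_natl mulKf ?gt_eqF//.
by rewrite mulrCA mulrA.
Qed.

Lemma gstep_dist_Holder d1 t w w' : K w -> K w' ->
  enorm (gstep d1 t w - gstep d1 t w') <= gfun lam (enorm (w - w')) (eta * L).
Proof.
move=> Kw Kw'.
rewrite (le_trans (gstep_dist (c := fun=> L * enorm (w - w') `^ lam) _))//.
  by move=> i _; exact: clip_grad_Holder.
rewrite sumr_const card_batch -[(L * _) *+ b]mulr_natl mulKf ?gt_eqF//.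
by rewrite /gfun mulrA.
Qed.

Lemma gstep_adj t w : istar \notin batch t -> gstep D t w = gstep D' t w.
Proof.
move=> tB; rewrite /gstep; congr (_ - _ *: (_ *: _)).
apply: eq_bigr => i iB; rewrite hadj//.
by apply: contraNneq tB => <-.
Qed.

(** The [b - 1] common samples are Hoelder; the sample [istar] can differ by the full clipping
    diameter [2 * Kc]. *)
Lemma gstep_dist_star t w w' : K w -> K w' -> istar \in batch t ->
  enorm (gstep D t w - gstep D' t w') <=
  gfun lam (enorm (w - w')) (eta * L * (b%:R - 1) / b%:R) + 2 * eta * Kc / b%:R.
Proof.
move=> Kw Kw' tB.
rewrite (le_trans (gstep_dist
  (c := fun i => if i == istar then 2 * Kc else L * enorm (w - w') `^ lam) _))//.
  move=> i _; case: eqVneq => [_|ii]; first exact: clip_diff_le2.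
  by rewrite -hadj//; exact: clip_grad_Holder.
rewrite (bigD1 istar)//= eqxx.
rewrite (eq_bigr (fun=> L * enorm (w - w') `^ lam)); last first.
  by move=> i /andP[_ /negbTE ->].
rewrite sumr_const.
have -> : #|[pred i in batch t | i != istar]| = b.-1.
  rewrite -(card_batch t) (cardsD1 istar (batch t)) tB /=.
  by apply: eq_card => i; rewrite !inE andbC.
rewrite -[_ *+ b.-1]mulr_natl -subn1 natrB// /gfun -addrA lerD2l le_eqVlt; apply/orP; left.
by apply/eqP; field; rewrite gt_eqF.
Qed.

(** At a common point only the sample [istar] contributes. This is the origin of the constant
    [2 * Kc * eta / b] in the final bound. *)
Lemma gstep_same t w :
  enorm (gstep D t w - gstep D' t w) <=
  2 * Kc * eta / b%:R * (istar \in batch t)%:R.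
Proof.
case: (boolP (istar \in batch t)) => tB; last first.
  by rewrite gstep_adj// subrr enorm0 mulr0.
rewrite (le_trans (gstep_dist (c := fun i => if i == istar then 2 * Kc else 0) _))//.
  move=> i _; case: eqVneq => [_|ii]; first exact: clip_diff_le2.
  by rewrite -hadj// subrr enorm0.
rewrite subrr enorm0 add0r (bigD1 istar)//= eqxx big1 ?addr0; last first.
  by move=> i /andP[_ /negbTE ->].
rewrite mulr1 le_eqVlt; apply/orP; left.
by apply/eqP; field; rewrite gt_eqF.
Qed.

Variables (W0 : vec) (hW0 : K W0).

Lemma sgd_iterS data g t :
  sgd_iter proj grad data batch eta Kc b g W0 t.+1 =
  proj (gstep data t (sgd_iter proj grad data batch eta Kc b g W0 t) + g t).
Proof. by []. Qed.

Lemma sgd_iter_in data g t : K (sgd_iter proj grad data batch eta Kc b g W0 t).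
Proof. by case: t => // t; exact: (hproj _).1. Qed.

Variables (tau : nat) (a : nat -> R).

(* Once [tau] is reached the first component is steered towards the second:
   the shift cancels up to [a t] of their distance, and, when [istar] is in the
   batch, also the difference between the two data sets. *)
Definition steer t (w w' : vec) : vec :=
  if (tau <= t)%N then
    clip (a t) (gstep D t w - gstep D t w') + (gstep D t w' - gstep D' t w')
  else 0.

Fixpoint coupled (g : nat -> vec) t : vec * vec :=
  match t with
  | 0 => (W0, W0)
  | t'.+1 => let ww := coupled g t' in
     (proj (gstep D t' ww.1 + (g t' - steer t' ww.1 ww.2)),
      proj (gstep D' t' ww.2 + g t'))
  end.

Definition steer_at g t := steer t (coupled g t).1 (coupled g t).2.

(** The first component is a genuine run on [D] under the noise [g - s]: the form in which
    Girsanov's formula can be applied to it. *)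
Lemma coupled1E g t : (coupled g t).1 =
  sgd_iter proj grad D batch eta Kc b (fun s => g s - steer_at g s) W0 t.
Proof. by elim: t => // t IH; rewrite sgd_iterS -IH. Qed.

Lemma coupled2E g t : (coupled g t).2 =
  sgd_iter proj grad D' batch eta Kc b g W0 t.
Proof. by elim: t => // t IH; rewrite sgd_iterS -IH. Qed.

Lemma eq_coupled g g' t : (forall s, (s < t)%N -> g s = g' s) ->
  coupled g t = coupled g' t.
Proof.
by elim: t => // t IH H /=; rewrite IH ?H// => s st; apply: H; exact: ltnW.
Qed.

(** The strict inequality makes the shift predictable, as [s_adapted] demands. *)
Lemma eq_steer_at g g' t : (forall s, (s < t)%N -> g s = g' s) ->
  steer_at g t = steer_at g' t.
Proof. by move=> H; rewrite /steer_at (eq_coupled H). Qed.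

Lemma coupled1_in g t : K (coupled g t).1.
Proof. by rewrite coupled1E; exact: sgd_iter_in. Qed.

Lemma coupled2_in g t : K (coupled g t).2.
Proof. by rewrite coupled2E; exact: sgd_iter_in. Qed.

Notation dist g t := (enorm ((coupled g t).1 - (coupled g t).2)).

(** Both components receive the same [g t], which cancels; only the shift survives. *)
Lemma dist_step g t : dist g t.+1 <=
  enorm (gstep D t (coupled g t).1 - gstep D' t (coupled g t).2 - steer_at g t).
Proof.
rewrite (le_trans (projection_nonexpansive Kconv hproj _ _))//.
rewrite -/(steer_at g t) le_eqVlt; apply/orP; left; apply/eqP; congr enorm.
by apply/rowP => i; rewrite !mxE; ring.
Qed.

Lemma gfun_mono x y M : 0 <= M -> 0 <= x -> x <= y -> gfun lam x M <= gfun lam y M.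
Proof.
move=> M0 x0 xy; have y0 := le_trans x0 xy; rewrite /gfun lerD// ler_wpM2l//.
by rewrite ge0_ler_powR ?nnegrE// ltW.
Qed.

Notation Ds := (Dseq batch b istar eta Kc L lam).
Notation tEs := (tE batch b istar).
Hypothesis notin_batch_lt_tE0 : forall t, (t < tEs 0)%N -> istar \notin batch t.
Hypothesis mem_batch_tE : forall e, istar \in batch (tEs e).
Hypothesis mem_batchE : forall t, istar \in batch t -> exists e, t = tEs e.

Lemma Dseq0 t : (t <= tEs 0)%N -> Ds t = 0.
Proof. by case: t => //= t ->. Qed.

(** Without steering, the branches of [Dseq] are the one-step estimates above. The first shifted
    step leads from [tau] to [tau + 1], so time [tau] itself is still covered. *)
Lemma dist_le_Dseq g t : (t <= tau)%N -> dist g t <= Ds t.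
Proof.
elim: t => [_|t IH tt]; first by rewrite /= subrr enorm0.
have {}IH := IH (ltnW tt); rewrite (le_trans (dist_step _ _))//.
rewrite {1}/steer_at /steer leqNgt tt subr0.
(* Until [istar] is first used the two runs coincide. *)
have eq0 : (t <= tEs 0)%N -> (coupled g t).1 = (coupled g t).2.
  move=> t0; apply/subr0_eq/enorm_eq0/le_anti; rewrite enorm_ge0 andbT.
  by rewrite -(Dseq0 t0).
have Kw := coupled1_in g t; have Kw' := coupled2_in g t.
have d0 := enorm_ge0 ((coupled g t).1 - (coupled g t).2).
move=> /=; case: ifPn => [t0|t0].
  have tB := notin_batch_lt_tE0 t0.
  by rewrite eq0 ?(ltnW t0)// (gstep_adj _ tB) subrr enorm0 lexx.
case: eqP => [t0E|t0E].
  rewrite eq0 ?t0E// (le_trans (gstep_same _ _))//.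
  case: (_ \in _); rewrite ?mulr1 ?mulr0; first by rewrite (mulrAC 2) lexx.
  by rewrite !mulr_ge0// ?invr_ge0 ltW.
case: asboolP => [[e [_ te]]|nE].
  have tB : istar \in batch t by rewrite te mem_batch_tE.
  rewrite le_min; apply/andP; split.
    rewrite (le_trans (gstep_dist_star _ _ _))// lerD2r gfun_mono//.
    rewrite !mulr_ge0// ?invr_ge0 ?(ltW heta) ?(ltW b0R)//.
    by rewrite subr_ge0 ler1n.
  by rewrite (le_trans (gstep_dist_clip _ _ _ _ _))// lerD2r.
(* Neither [t_0] nor a later [t_e]: both data sets prescribe the same step. *)
have tB : istar \notin batch t.
  apply/negP => /mem_batchE[[|e] te]; first exact: t0E.
  by apply: nE; exists e.+1.
rewrite le_min -gstep_adj//; apply/andP; split.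
  rewrite (le_trans (gstep_dist_Holder _ _ _ _))// gfun_mono//.
  by rewrite mulr_ge0// ltW.
by rewrite (le_trans (gstep_dist_clip _ _ _ _ _))// lerD2r.
Qed.

Variables (h : R -> R) (T : nat).
Hypothesis hh : forall y, 0 <= y -> 0 <= h y /\ h y + eta * L * (h y) `^ lam = y.
Hypothesis tauT : (tau < T)%N.
Hypothesis a0 : forall t, (tau <= t < T)%N -> 0 <= a t.

Lemma Aseq_ge0 t : (tau <= t <= T)%N -> 0 <= Aseq h a T t.
Proof.
move=> /andP[taut tT]; rewrite /Aseq.
have : (T - t <= T - tau)%N by rewrite leq_sub2l.
elim: (T - t)%N => //= k IH kT; apply: (hh _).1.
rewrite addr_ge0 ?IH//; first exact: ltnW.
apply: a0; rewrite ltn_subrL/= (leq_trans _ tauT)// andbT.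
by rewrite leq_subRL ?(leq_trans kT) ?leq_subr// addnC -leq_subRL// ltnW.
Qed.

Lemma AseqE t : (t < T)%N -> Aseq h a T t = h (Aseq h a T t.+1 + a t).
Proof.
move=> tT; rewrite /Aseq -[in LHS](subnSK tT)/= subnSK// subKn//.
exact: ltnW.
Qed.

Hypothesis D_le_A : Ds tau <= Aseq h a T tau.

(** Although [A] is defined backwards, the induction runs forwards: a gradient step expands [A_t] to
    at most [A_{t+1} + a_t], and the clipped part of the steering removes [a_t]. *)
Lemma dist_le_Aseq g t : (tau <= t <= T)%N -> dist g t <= Aseq h a T t.
Proof.
move=> /andP[taut]; elim: t taut => [|t IH].
  rewrite leqn0 => /eqP tau0 _.
  by have := le_trans (dist_le_Dseq g (leqnn tau)) D_le_A; rewrite tau0.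
rewrite leq_eqVlt ltnS => /predU1P[<- _|taut tT].
  by rewrite (le_trans _ D_le_A)// dist_le_Dseq.
have {}IH := IH taut (ltnW tT).
have At1 : 0 <= Aseq h a T t.+1 by rewrite Aseq_ge0// tT leqW.
have at0 : 0 <= a t by rewrite a0// taut.
have Kw := coupled1_in g t; have Kw' := coupled2_in g t.
rewrite (le_trans (dist_step _ _))// /steer_at /steer taut.
set Delta := gstep D t _ - gstep D t _.
(* The unclipped part of the steering replaces the [D']-step of the second run by a [D]-step, so
   [Delta] compares two points under one data set. *)
have -> : gstep D t (coupled g t).1 - gstep D' t (coupled g t).2 -
    (clip (a t) Delta + (gstep D t (coupled g t).2 - gstep D' t (coupled g t).2))
    = Delta - clip (a t) Delta.
  by apply/rowP => i; rewrite !mxE; ring.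
apply: enorm_sub_clip => //.
rewrite (le_trans (gstep_dist_Holder _ _ _ _))//.
(* As [h] inverts the expansion map, [gfun] of [A_t] equals [A_{t+1} + a_t]. *)
have [_ hA] := hh (addr_ge0 At1 at0).
rewrite -[leRHS]hA -AseqE// -/(gfun _ _ _) gfun_mono// ?enorm_ge0//.
by rewrite mulr_ge0// ltW.
Qed.

Lemma coupled_end g : (coupled g T).1 = (coupled g T).2.
Proof.
apply/subr0_eq/enorm_eq0/le_anti; rewrite enorm_ge0 andbT.
rewrite (le_trans (dist_le_Aseq _ _)) ?leqnn ?(ltnW tauT)//.
by rewrite /Aseq subnn.
Qed.

Lemma enorm_steer_le t w w' : (t < T)%N -> enorm (steer t w w') <=
  if (tau <= t)%N then a t + 2 * Kc * eta / b%:R * (istar \in batch t)%:R else 0.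
Proof.
move=> tT; rewrite /steer; case: ifPn => taut; last by rewrite enorm0.
rewrite (le_trans (enormD _ _))// lerD ?gstep_same// enorm_clip_le// a0//.
by rewrite taut.
Qed.

End steps.

(** * Measurability of the iterates *)

Section measurable_vectors.
Variables (R : realType) (d : nat).
Notation vec := 'rV[R]_d.

Lemma enorm_le_sum (u : vec) : enorm u <= \sum_i `|u ord0 i|.
Proof.
rewrite {1}(row_sum_delta u) (le_trans (enorm_sum _ _ _))//.
apply: ler_sum => i _; rewrite enormZ ler_piMr//.
rewrite enormE -[leRHS]sqrtr1 ler_sqrt// /dot (bigD1 i)//= big1 ?addr0.
  by rewrite !mxE !eqxx/= mulr1.
by move=> j /negbTE ji; rewrite !mxE ji andbF mul0r.
Qed.

(** Continuity in terms of [enorm], the norm in which the projection and Hoelder estimates are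
    given. *)
Definition enorm_continuous m (F : vec -> 'rV[R]_m) : Prop :=
  forall u e, 0 < e -> exists2 r, 0 < r &
    forall v, enorm (u - v) < r -> enorm (F u - F v) < e.

Variables (dE : measure_display) (E : measurableType dE).

Definition measurable_vec m (v : E -> 'rV[R]_m) : Prop :=
  forall i, measurable_fun setT (fun y => v y ord0 i).

(* An open set is the union of the rational boxes it contains. *)
Lemma measurable_fun_box (F : vec -> R) (v : E -> vec) : measurable_vec v ->
  (forall u e, 0 < e -> exists2 r, 0 < r &
    forall w, enorm (u - w) < r -> `|F u - F w| < e) ->
  measurable_fun setT (F \o v).
Proof.
move=> mv cF; apply: (measurability _ (RGenOInfty.measurableE R)) => //.
move=> _ [_ [x ->] <-]; rewrite setTI.
pose J := ({ffun 'I_d -> rat} * rat)%type.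
pose box (p : J) := [set u : vec | forall i, `|u ord0 i - ratr (p.1 i)| < ratr p.2].
pose good : set J := [set p | forall u, box p u -> x < F u].
have -> : (F \o v) @^-1` `]x, +oo[%classic =
    \bigcup_p [set y | good p /\ box p (v y)].
  apply/seteqP; split=> [y /=|y [p _ [gp bp]]]; last first.
    by rewrite /= in_itv/= andbT; exact: gp.
  rewrite in_itv/= andbT => xF; set u := v y.
  have [|r r0 Hr] := cF u (F u - x); first by rewrite subr_gt0.
  have d2 : 0 < 2 * (d.+1%:R : R) by rewrite mulr_gt0// ltr0n.
  (* Points of a box of half-width [q] differ by less than [2 * q] in each coordinate, hence by less
     than [r] in norm; [d.+1] also covers [d = 0]. *)
  have /rat_in_itvoo[q] : 0 < r / (2 * d.+1%:R) by rewrite divr_gt0.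
  rewrite in_itv/= => /andP[q0 qr].
  have cl i : {p : rat | `|u ord0 i - ratr p| < ratr q :> R}.
    apply: cid; have /rat_in_itvoo[p] : u ord0 i - ratr q < u ord0 i + ratr q.
      by rewrite ltrD2l gt0_cp.
    rewrite in_itv/= => /andP[p1 p2]; exists p.
    by rewrite ltr_norml; apply/andP; split; lra.
  exists ([ffun i => sval (cl i)], q) => //; split; last first.
    by move=> i /=; rewrite ffunE; exact: svalP (cl i).
  move=> w bw; have : `|F u - F w| < F u - x.
    apply: Hr; rewrite (le_lt_trans (enorm_le_sum _))//.
    apply: (@le_lt_trans _ _ (\sum_(i < d) (2 * ratr q))).
      apply: ler_sum => i _; rewrite !mxE.
      have := bw i; rewrite /= ffunE; have := svalP (cl i); set p := ratr _.
      rewrite !ltr_norml ler_norml => /andP[? ?] /andP[? ?].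
      by apply/andP; split; lra.
    rewrite sumr_const card_ord -[_ *+ d]mulr_natr.
    move: qr; rewrite ltr_pdivlMr// => qr; rewrite (le_lt_trans _ qr)//.
    rewrite [leRHS]mulrCA mulrA ler_wpM2l//; last by rewrite ler_nat.
    by rewrite mulr_ge0// ltW.
  by rewrite ltr_norml => /andP[]; lra.
apply: countable_bigcupT_measurable => [|p]; first exact: countableP.
have [gp|ngp] := pselect (good p); last first.
  by rewrite (_ : [set _ | _] = set0)//; apply/seteqP; split=> y // [].
rewrite (_ : [set _ | _] = \bigcap_(i in [set: 'I_d]) ((fun y => v y ord0 i) @^-1`
    `]ratr (p.1 i) - ratr p.2, ratr (p.1 i) + ratr p.2[%classic)).
  apply: fin_bigcap_measurable => // i _.
  by rewrite -[X in measurable X]setTI; exact: mv.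
apply/seteqP; split=> y /=.
  by move=> [_ bp] i _; rewrite /= in_itv/= -ltr_distl.
move=> H; split=> // i; have := H i I; rewrite /= in_itv/=.
by rewrite -ltr_distl.
Qed.

Lemma measurable_vec_comp m (F : vec -> 'rV[R]_m) (v : E -> vec) :
  measurable_vec v -> enorm_continuous F -> measurable_vec (F \o v).
Proof.
move=> mv cF i; apply: (@measurable_fun_box (fun u => F u ord0 i) v mv).
move=> u e e0; have [r r0 Hr] := cF u e e0; exists r => // w uw.
apply: le_lt_trans (Hr w uw).
by have := coord_le_enorm (F u - F w) i; rewrite !mxE.
Qed.

Lemma measurable_vec_add m (v w : E -> 'rV[R]_m) :
  measurable_vec v -> measurable_vec w -> measurable_vec (fun y => v y + w y).
Proof.
move=> mv mw i; rewrite (_ : (fun _ => _) = (fun y => v y ord0 i + w y ord0 i)).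
  exact: measurable_funD.
by apply/funext => y; rewrite mxE.
Qed.

Lemma measurable_vec_scale m k (v : E -> 'rV[R]_m) :
  measurable_vec v -> measurable_vec (fun y => k *: v y).
Proof.
move=> mv i; rewrite (_ : (fun _ => _) = (fun y => k * v y ord0 i)).
  exact: measurable_funM.
by apply/funext => y; rewrite mxE.
Qed.

Lemma measurable_vec_sub m (v w : E -> 'rV[R]_m) :
  measurable_vec v -> measurable_vec w -> measurable_vec (fun y => v y - w y).
Proof.
move=> mv mw; apply: measurable_vec_add => //.
rewrite (_ : (fun _ => _) = (fun y => -1 *: w y)); first exact: measurable_vec_scale.
by apply/funext => y; rewrite scaleN1r.
Qed.

Lemma measurable_vec_sum m (J : finType) (Q : pred J) (v : J -> E -> 'rV[R]_m) :
  (forall j, measurable_vec (v j)) ->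
  measurable_vec (fun y => \sum_(j | Q j) v j y).
Proof.
move=> mv i; rewrite (_ : (fun _ => _) =
  (fun y => \sum_(j <- enum Q) v j y ord0 i)); last first.
  by apply/funext => y; rewrite summxE big_enum.
by apply: measurable_sum => j; exact: mv.
Qed.

Lemma measurable_vec_cst m (u : 'rV[R]_m) : measurable_vec (fun=> u).
Proof. by move=> i; exact: measurable_cst. Qed.

Lemma nonexpansive_continuous m (F : vec -> 'rV[R]_m) :
  (forall u v, enorm (F u - F v) <= enorm (u - v)) -> enorm_continuous F.
Proof. by move=> H u e e0; exists e => // v; exact: le_lt_trans. Qed.

Lemma Hoelder_continuous m (F : vec -> 'rV[R]_m) (L lam : R) :
  0 <= L -> 0 < lam ->
  (forall u v, enorm (F u - F v) <= L * enorm (u - v) `^ lam) ->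
  enorm_continuous F.
Proof.
move=> L0 lam0 H u e e0.
(* [L] may vanish, hence the radius is built from [L + 1]. *)
have L1 : 0 < L + 1 by rewrite ltr_wpDl.
have eL : 0 < e / (L + 1) by rewrite divr_gt0.
exists ((e / (L + 1)) `^ lam^-1); first exact: powR_gt0.
move=> v uv; rewrite (le_lt_trans (H _ _))//.
have : enorm (u - v) `^ lam <= e / (L + 1).
  have -> : e / (L + 1) = ((e / (L + 1)) `^ lam^-1) `^ lam.
    by rewrite -powRrM mulVf ?gt_eqF// powRr1// ltW.
  by rewrite ge0_ler_powR ?nnegrE ?enorm_ge0 ?powR_ge0// ltW.
rewrite ler_pdivlMr// mulrC => Hs.
have := powR_ge0 (enorm (u - v)) lam.
have [->|s0] := eqVneq (enorm (u - v) `^ lam) 0; first by rewrite mulr0.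
by rewrite le_eqVlt eq_sym (negbTE s0)/= => sp; rewrite (lt_le_trans _ Hs)// mulrDl mul1r ltrDl.
Qed.

End measurable_vectors.

Lemma measurable_rv2tuple (R : realType) (d : nat) (dE : measure_display)
    (E : measurableType dE) (v : E -> 'rV[R]_d) :
  measurable_vec v -> measurable_fun setT (fun y => rv2tuple (v y)).
Proof.
move=> mv; apply/measurable_fun_tnthP => i.
rewrite (_ : _ \o _ = (fun y => v y ord0 i))//.
by apply/funext => y /=; rewrite tnth_mktuple.
Qed.

Section measurable_coupling.
Variables (R : realType) (d : nat).
Notation vec := 'rV[R]_d.
Variables (K : set vec) (proj : vec -> vec).
Hypothesis Kconv : forall x y t, K x -> K y -> 0 <= t <= 1 -> K (x + t *: (y - x)).
Hypothesis hproj : is_projection K proj.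
Variables (X : Type) (grad : X -> vec -> vec) (L lam : R).
Hypotheses (hL : 0 <= L) (lam0 : 0 < lam).
Hypothesis hHolder : forall (z : X) (w w' : vec), K w -> K w' ->
     enorm (grad z w - grad z w') <= L * enorm (w - w') `^ lam.
Variables (eta Kc : R).
Hypothesis hKc : 0 <= Kc.
Variables (n b : nat) (batch : nat -> {set 'I_n}).
Variables (W0 : vec) (hW0 : K W0).
Variables (dE : measure_display) (E : measurableType dE).

Lemma measurable_vec_proj (v : E -> vec) : measurable_vec v ->
  measurable_vec (fun y => proj (v y)).
Proof.
move=> mv; apply: (measurable_vec_comp mv); apply: nonexpansive_continuous.
exact: projection_nonexpansive Kconv hproj.
Qed.

Lemma measurable_vec_clip k (v : E -> vec) : 0 <= k -> measurable_vec v ->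
  measurable_vec (fun y => clip k (v y)).
Proof.
move=> k0 mv; apply: (measurable_vec_comp mv); apply: nonexpansive_continuous.
by move=> u w; exact: clip_nonexpansive.
Qed.

(* [grad z] is only controlled on [K]; precomposing it with the projection
   makes it continuous everywhere. *)
Lemma measurable_vec_grad z (v : E -> vec) : (forall y, K (v y)) ->
  measurable_vec v -> measurable_vec (fun y => grad z (v y)).
Proof.
move=> Kv mv.
rewrite (_ : (fun _ => _) = (grad z \o proj) \o v).
  apply: (measurable_vec_comp mv); apply: (Hoelder_continuous hL lam0) => u w /=.
  have := hHolder z (hproj u).1 (hproj w).1; move/le_trans; apply.
  apply: (ler_wpM2l hL); apply: (ge0_ler_powR (ltW lam0)).
  - by rewrite nnegrE enorm_ge0.
  - by rewrite nnegrE enorm_ge0.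
  - exact: (projection_nonexpansive Kconv hproj).
by apply/funext => y /=; rewrite (projection_id hproj).
Qed.

Lemma measurable_vec_gstep (data : 'I_n -> X) t (v : E -> vec) :
  (forall y, K (v y)) -> measurable_vec v ->
  measurable_vec (fun y => gstep grad eta Kc b batch data t (v y)).
Proof.
move=> Kv mv; apply: measurable_vec_sub => //.
apply: measurable_vec_scale; apply: measurable_vec_scale.
apply: measurable_vec_sum => i; apply: measurable_vec_clip => //.
exact: measurable_vec_grad.
Qed.

Variable g : E -> nat -> vec.
Hypothesis mg : forall t, measurable_vec (g ^~ t).

Lemma measurable_vec_sgd (data : 'I_n -> X) t :
  measurable_vec (fun y => sgd_iter proj grad data batch eta Kc b (g y) W0 t).
Proof.
elim: t => [|t IH]; first exact: measurable_vec_cst.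
apply: measurable_vec_proj; apply: measurable_vec_add => //.
apply: measurable_vec_gstep => // y.
exact: (sgd_iter_in hproj).
Qed.

Variables (D D' : 'I_n -> X) (tau : nat) (a : nat -> R).
Notation str := (steer grad eta Kc b batch D D' tau a).
Notation cpl := (coupled proj grad eta Kc b batch D D' W0 tau a).

Lemma measurable_vec_steer t (v w : E -> vec) : ((tau <= t)%N -> 0 <= a t) ->
  (forall y, K (v y)) -> (forall y, K (w y)) ->
  measurable_vec v -> measurable_vec w ->
  measurable_vec (fun y => str t (v y) (w y)).
Proof.
move=> + Kv Kw mv mw; rewrite /steer; case: (tau <= t)%N => [/(_ isT) at0|_].
  apply: measurable_vec_add; first apply: measurable_vec_clip => //.
    by apply: measurable_vec_sub; exact: measurable_vec_gstep.
  by apply: measurable_vec_sub; exact: measurable_vec_gstep.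
exact: measurable_vec_cst.
Qed.

Lemma measurable_vec_coupled t : (forall s, (tau <= s < t)%N -> 0 <= a s) ->
  measurable_vec (fun y => (cpl (g y) t).1) /\
  measurable_vec (fun y => (cpl (g y) t).2).
Proof.
elim: t => [_|t IH at0].
  by split; exact: measurable_vec_cst.
have /IH[m1 m2] : forall s, (tau <= s < t)%N -> 0 <= a s.
  by move=> s /andP[s1 s2]; apply: at0; rewrite s1 ltnW.
have K1 y : K (cpl (g y) t).1 by exact: (coupled1_in hproj).
have K2 y : K (cpl (g y) t).2 by exact: (coupled2_in hproj).
split; apply: measurable_vec_proj; apply: measurable_vec_add => //.
- exact: measurable_vec_gstep.
- apply: measurable_vec_sub => //; apply: measurable_vec_steer => // taut.
  by apply: at0; rewrite taut ltnSn.
- exact: measurable_vec_gstep.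
Qed.

End measurable_coupling.

(** * Noise coordinates and privacy budget *)

Lemma sum_ord_mul (V : nmodType) (F : nat -> V) (T d : nat) :
  \sum_(j < T * d) F j = \sum_(t < T) \sum_(i < d) F (t * d + i)%N.
Proof.
elim: T => [|T IH]; first by rewrite mul0n !big_ord0.
rewrite big_ord_recr/= -IH mulSn addnC -!(big_mkord xpredT F).
rewrite (@big_cat_nat _ _ _ (T * d))//= ?leq_addr//; congr (_ + _).
by rewrite -{1}(add0n (T * d)%N) big_addn addKn big_mkord; apply: eq_bigr => i _; rewrite addnC.
Qed.

Section flatten.
Context (R : realType) (d T : nat).
Notation vec := 'rV[R]_d.
Notation N := (T * d)%N.

(** Step [t] occupies the positions [t * d + i] with [i < d]. The default 0 is reached only for
    [d = 0]. *)
Definition flat_entry (v : vec) (j : nat) : R :=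
  if insub (j %% d)%N is Some i then v ord0 i else 0.

Lemma flat_entry_mulD v t (i : 'I_d) : flat_entry v (t * d + i) = v ord0 i.
Proof. by rewrite /flat_entry modnMDl modn_small// valK. Qed.

Lemma divn_mulD t (i : 'I_d) : ((t * d + i) %/ d)%N = t.
Proof.
by rewrite divnMDl ?divn_small ?addn0// (leq_ltn_trans _ (ltn_ord i)).
Qed.

Lemma ltn_mulD t (i : 'I_d) : (t < T)%N -> (t * d + i < N)%N.
Proof.
move=> tT; apply: (@leq_trans (t.+1 * d)); last by rewrite leq_mul2r tT orbT.
by rewrite mulSn addnC ltn_add2r.
Qed.

Definition unflat (y : N.-tuple R) (t : nat) : vec := \row_i y`_(t * d + i).

Lemma sum_sqr_flat_entry (v : nat -> vec) :
  \sum_(j < N) flat_entry (v (j %/ d)%N) j ^+ 2 = \sum_(t < T) enorm (v t) ^+ 2.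
Proof.
rewrite (sum_ord_mul (fun j => flat_entry (v (j %/ d)%N) j ^+ 2)).
apply: eq_bigr => t _; rewrite sqr_enorm; apply: eq_bigr => i _.
by rewrite divn_mulD flat_entry_mulD expr2.
Qed.

Context (sigma : R) (dO : measure_display).
Context (Omega : measurableType dO) (P : probability Omega R).
Variable G : nat -> 'I_d -> Omega -> R.
Hypothesis hGmeas : forall t i, measurable_fun setT (G t i).
Hypothesis hGlaw : forall t i (A : set R), measurable A ->
     P (G t i @^-1` A) = normal_prob 0 sigma A.
Hypothesis hGindep : forall (s : seq (nat * 'I_d)) (A : nat * 'I_d -> set R),
     uniq s -> (forall j, measurable (A j)) ->
     P (\big[setI/setT]_(j <- s) (G j.1 j.2 @^-1` A j)) =
     (\prod_(j <- s) P (G j.1 j.2 @^-1` A j))%E.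

Definition flat (j : nat) (w : Omega) : R :=
  if insub (j %% d)%N is Some i then G (j %/ d) i w else 0.

Lemma flat_mulD t (i : 'I_d) w : flat (t * d + i) w = G t i w.
Proof. by rewrite /flat modnMDl modn_small// valK divn_mulD. Qed.

Lemma measurable_flat j : measurable_fun setT (flat j).
Proof. by rewrite /flat; case: insub. Qed.

Lemma flatE j : (j < N)%N -> exists2 i : 'I_d, (j %% d)%N = i & flat j = G (j %/ d) i.
Proof.
move=> jN; have d0 : (0 < d)%N by case: (d) jN => //; rewrite muln0.
exists (Ordinal (ltn_pmod j d0)) => //; apply/funext => w.
by rewrite -flat_mulD -divn_eq.
Qed.

Lemma flat_law j : (j < N)%N -> forall A, measurable A ->
  P (flat j @^-1` A) = normal_prob 0 sigma A.
Proof. by move=> /flatE[i _ ->] A mA; exact: hGlaw. Qed.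

(** Quotient and remainder by [d] map positions injectively to pairs (time, coordinate), where
    independence is assumed. *)
Lemma flat_indep k : (k <= N)%N -> forall A : nat -> set R,
  (forall j, measurable (A j)) ->
  P (\big[setI/setT]_(j < k) (flat j @^-1` A j)) =
  (\prod_(j < k) P (flat j @^-1` A j))%E.
Proof.
move=> kN A mA; case: (posnP k) => [->|k0].
  by rewrite !big_ord0 probability_setT.
have d0 : (0 < d)%N by rewrite lt0n; apply: contraTneq kN => ->; rewrite muln0 -ltnNge.
pose f j := (j %/ d, Ordinal (ltn_pmod j d0))%N.
pose A' (p : nat * 'I_d) := A (p.1 * d + p.2)%N.
have fE j : G (f j).1 (f j).2 = flat j.
  by apply/funext => w; rewrite -flat_mulD -divn_eq.
have AE j : A' (f j) = A j by rewrite /A' /= -divn_eq.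
have funi : uniq (map f (iota 0 k)).
  rewrite map_inj_uniq ?iota_uniq// => j1 j2 [e1 e2].
  by rewrite (divn_eq j1 d) (divn_eq j2 d) e1 e2.
have := hGindep funi (fun p => mA _ : measurable (A' p)); rewrite !big_map.
rewrite (eq_bigr (fun j => flat j @^-1` A j)); last first.
  by move=> j _; rewrite AE fE.
rewrite [in RHS](eq_bigr (fun j => P (flat j @^-1` A j))); last first.
  by move=> j _; rewrite AE fE.
rewrite -(big_mkord xpredT (fun j => flat j @^-1` A j)).
rewrite -(big_mkord xpredT (fun j => P (flat j @^-1` A j))).
by rewrite /index_iota subn0.
Qed.

Lemma unflat_hist t w : (t < T)%N -> unflat (hist N flat N w) t = \row_i G t i w.
Proof.
move=> tT; apply/rowP => i; rewrite !mxE nth_mktup; last exact: ltn_mulD.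
by rewrite ltn_mulD// flat_mulD.
Qed.

End flatten.

(** * Splitting the cost of a step between data and distance *)

Section budget.
Variable R : realType.
Implicit Types (alpha beta sigma a c : R).

Lemma ediv_ge0 (x y : R) : 0 <= x -> 0 <= y -> (0 <= ediv x y)%E.
Proof.
move=> x0 y0; rewrite /ediv; case: ifP => _; last by rewrite lee_fin divr_ge0.
by case: ifP.
Qed.

(** At [beta = 0] or [beta = 1] one denominator vanishes: the convention for [x / 0] makes the right
    side infinite, unless the numerator vanishes too and equality holds. *)
Lemma ediv_split alpha beta sigma a c : 0 < alpha -> 0 < sigma ->
  0 <= beta <= 1 -> 0 <= a -> 0 <= c ->
  ((alpha * (a + c) ^+ 2 / (2 * sigma ^+ 2))%:E <=
   ediv (alpha * c ^+ 2) (2 * beta * sigma ^+ 2) +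
   ediv (alpha * a ^+ 2) (2 * sigma ^+ 2 * (1 - beta)))%E.
Proof.
move=> al0 s0 /andP[b0 b1] a0 c0.
have ss : 0 < sigma ^+ 2 by rewrite exprn_gt0.
have D1 : 0 <= 2 * beta * sigma ^+ 2 by rewrite !mulr_ge0// ltW.
have D2 : 0 <= 2 * sigma ^+ 2 * (1 - beta).
  by rewrite !mulr_ge0 ?subr_ge0// ltW.
have N1 : 0 <= alpha * c ^+ 2 by rewrite mulr_ge0 ?sqr_ge0// ltW.
have N2 : 0 <= alpha * a ^+ 2 by rewrite mulr_ge0 ?sqr_ge0// ltW.
have ny (x : \bar R) : (0 <= x)%E -> x != -oo%E by case: x.
have P1 := ediv_ge0 N1 D1; have P2 := ediv_ge0 N2 D2.
have [beta0|bn0] := eqVneq beta 0.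
  have [->|cn0] := eqVneq c 0.
    by rewrite beta0 /ediv mulr0 mul0r expr0n mulr0 !eqxx add0e subr0 mulr1 addr0
      mulf_eq0 pnatr_eq0 expf_eq0/= gt_eqF.
  rewrite [X in (X + _)%E](_ : _ = +oo%E) ?addye ?leey ?ny//.
  by rewrite /ediv beta0 mulr0 mul0r eqxx mulf_eq0 expf_eq0/= (gt_eqF al0) (negbTE cn0).
have [beta1|bn1] := eqVneq (1 - beta) 0.
  have [->|an0] := eqVneq a 0.
    have -> : beta = 1 by lra.
    by rewrite /ediv subrr mulr0 expr0n mulr0 !eqxx adde0 mulr1 add0r
      mulf_eq0 pnatr_eq0 expf_eq0/= gt_eqF.
  rewrite [X in (_ + X)%E](_ : _ = +oo%E) ?addey ?leey ?ny//.
  by rewrite /ediv beta1 mulr0 eqxx mulf_eq0 expf_eq0/= (gt_eqF al0) (negbTE an0).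
have bp : 0 < beta by rewrite lt0r bn0.
have bp1 : 0 < 1 - beta by rewrite lt0r bn1 subr_ge0.
rewrite /ediv !mulf_eq0 pnatr_eq0 (negbTE bn0) (negbTE bn1) (gt_eqF s0)/=.
rewrite -EFinD lee_fin -subr_ge0.
(* The gap is a square, zero exactly when [(1 - beta) * c = beta * a]. *)
have -> : alpha * c ^+ 2 / (2 * beta * sigma ^+ 2) +
   alpha * a ^+ 2 / (2 * sigma ^+ 2 * (1 - beta)) -
   alpha * (a + c) ^+ 2 / (2 * sigma ^+ 2) =
   alpha * ((1 - beta) * c - beta * a) ^+ 2 /
     (2 * sigma ^+ 2 * beta * (1 - beta)).
  by field; rewrite bn0 bn1 (gt_eqF s0).
apply: divr_ge0; first by rewrite mulr_ge0 ?sqr_ge0// ltW.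
by rewrite ltW// !mulr_gt0.
Qed.

Lemma ediv_beta0 alpha sigma a : 0 < sigma ->
  ediv (alpha * a ^+ 2) (2 * sigma ^+ 2 * (1 - 0)) =
  (alpha * a ^+ 2 / (2 * sigma ^+ 2))%:E.
Proof.
by move=> s0; rewrite subr0 mulr1 /ediv mulf_eq0 pnatr_eq0 expf_eq0/= gt_eqF.
Qed.

End budget.

(** * Sums over epochs as sums over steps *)

Section reindex.
Variables (R : realType) (n b : nat) (batch : nat -> {set 'I_n}) (istar : 'I_n).
Notation B := (n %/ b)%N.
Notation tEs := (tE batch b istar).
Hypothesis hbdisj : forall (e : nat) (i1 i2 : 'I_B), i1 != i2 ->
     forall j : 'I_n, j \in batch (e * B + i1)%N ->
       j \notin batch (e * B + i2)%N.
Hypothesis hbcover : forall (e : nat) (j : 'I_n),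
     exists i : 'I_B, j \in batch (e * B + i)%N.

(** The maps [e |-> t_e] and [t |-> t %/ B] are mutually inverse between the selected epochs and the
    steps using [istar]; [inord] only adapts index types, since [t %/ B <= t < T]. *)
Lemma sum_epochs (F : nat -> \bar R) (tau T : nat) : (tau < T)%N ->
  (\sum_(e < T | (tEs e <= T - 1)%N && (tau <= tEs e)%N) F (tEs e) =
   \sum_(tau <= t < T | istar \in batch t) F t)%E.
Proof.
case: T => // T _; rewrite subn1/=.
rewrite (reindex_onto (fun t : 'I_T.+1 => inord (t %/ B) : 'I_T.+1)
                      (fun e : 'I_T.+1 => inord (tEs e))) /=; last first.
  by move=> e /andP[eT _]; apply/val_inj; rewrite /= !inordK ?ltnS// ?divn_tE// -ltnS.
have dT (t : 'I_T.+1) : (inord (t %/ B) : 'I_T.+1) = (t %/ B)%N :> nat.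
  by rewrite inordK// (leq_ltn_trans (leq_div _ _)).
rewrite big_geq_mkord; apply: eq_big => [t|t].
  rewrite !dT; apply/andP/andP => [[/andP[H1 H2] /eqP H3]|[tB taut]].
    have te : t = tEs (t %/ B) :> nat by rewrite -[in LHS]H3 inordK// ltnS.
    by split; rewrite te// mem_batch_tE.
  have te : t = tEs (t %/ B) :> nat by exact: (mem_batchE hbdisj hbcover).
  split; first by rewrite -te taut andbT -ltnS.
  by apply/eqP/val_inj; rewrite /= -te inordK.
move=> /andP[/andP[H1 H2] /eqP H3]; rewrite !dT in H1 H3 *.
by rewrite -[in RHS]H3 inordK// ltnS.
Qed.

End reindex.

Lemma convex_set_segment (R : realType) (V : lmodType R) (K : set V) x y t :
  convex_set K -> K x -> K y -> 0 <= t <= 1 -> K (x + t *: (y - x)).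
Proof.
move=> Kc Kx Ky /andP[t0 t1].
have := Kc y x (Itv01 t0 t1); rewrite !inE => /(_ Ky Kx).
rewrite /conv/= /conv/=.
have -> : x + t *: (y - x) = t *: y + (1 - t) *: x.
  by rewrite scalerBr scalerBl scale1r addrCA addrA.
by [].
Qed.

(** Only noise before time [t] is read, so the infinite noise sequence may be replaced by a finite
    tuple. *)
Lemma eq_sgd_iter (R : realType) (d : nat) (proj : 'rV[R]_d -> 'rV[R]_d)
    (X : Type) (grad : X -> 'rV[R]_d -> 'rV[R]_d) (n : nat) (data : 'I_n -> X)
    batch eta Kc b g g' W0 t : (forall s, (s < t)%N -> g s = g' s) ->
  sgd_iter proj grad data batch eta Kc b g W0 t =
  sgd_iter proj grad data batch eta Kc b g' W0 t.
Proof.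
by elim: t => // t IH H /=; rewrite IH ?H// => s st; apply: H; exact: ltnW.
Qed.

(** The bound holds for each admissible [tau], [beta], [a], hence for the minimum. Restricting to
    [e < T] loses no epoch, because [e <= t_e]. *)
Theorem mainTheorem4
  (R : realType) (d : nat)
  (* the convex domain K, of diameter (at most) Dm, and the projection onto it *)
  (Kset : set 'rV[R]_d) (Dm : R) (proj : 'rV[R]_d -> 'rV[R]_d)
  (hKcl : closed Kset) (hKcv : convex_set Kset) (hKne : Kset !=set0)
  (hKdiam : forall x y, Kset x -> Kset y -> enorm (x - y) <= Dm)
  (hproj : is_projection Kset proj)
  (* data space, losses and their gradients *)
  (X : Type) (loss : X -> 'rV[R]_d -> R^o) (grad : X -> 'rV[R]_d -> 'rV[R]_d)
  (hdiff : forall (z : X) (w : 'rV[R]_d), Kset w ->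
     differentiable (loss z) w /\
     forall v : 'rV[R]_d, 'd (loss z) w v = \sum_(i < d) grad z w ord0 i * v ord0 i)
  (L lam : R) (hL : 0 <= L) (hlam : 0 < lam <= 1)
  (hHolder : forall (z : X) (w w' : 'rV[R]_d), Kset w -> Kset w' ->
     enorm (grad z w - grad z w') <= L * enorm (w - w') `^ lam)
  (* algorithm parameters *)
  (eta Kc sigma : R) (heta : 0 < eta) (hKc : 0 <= Kc) (hsigma : 0 < sigma)
  (W0 : 'rV[R]_d) (hW0 : Kset W0)
  (* h : inverse on R_{>=0} of x |-> x + eta L x^lam *)
  (h : R -> R)
  (hh : forall y, 0 <= y -> 0 <= h y /\ h y + eta * L * (h y) `^ lam = y)
  (* adjacent datasets differing exactly at istar *)
  (n : nat) (istar : 'I_n) (Dset Dset' : 'I_n -> X)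
  (hadj : forall i, i != istar -> Dset i = Dset' i)
  (hdiffer : Dset istar <> Dset' istar)
  (* a realisation of the shuffled cyclic mini-batch sequence *)
  (b : nat) (hb : (b %| n)%N) (batch : nat -> {set 'I_n})
  (hbsize : forall (e : nat) (i : 'I_(n %/ b)), #|batch (e * (n %/ b) + i)%N| = b)
  (hbdisj : forall (e : nat) (i1 i2 : 'I_(n %/ b)), i1 != i2 ->
     forall j : 'I_n, j \in batch (e * (n %/ b) + i1)%N ->
       j \notin batch (e * (n %/ b) + i2)%N)
  (hbcover : forall (e : nat) (j : 'I_n),
     exists i : 'I_(n %/ b), j \in batch (e * (n %/ b) + i)%N)
  (* the Gaussian noise: all coordinates G_t(i) i.i.d. N(0, sigma^2) *)
  (dO : measure_display) (Omega : measurableType dO) (P : probability Omega R)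
  (G : nat -> 'I_d -> Omega -> R)
  (hGmeas : forall t i, measurable_fun setT (G t i))
  (hGlaw : forall t i (A : set R), measurable A ->
     P (G t i @^-1` A) = normal_prob 0 sigma A)
  (hGindep : forall (s : seq (nat * 'I_d)) (A : nat * 'I_d -> set R),
     uniq s -> (forall j, measurable (A j)) ->
     P (\big[setI/setT]_(j <- s) (G j.1 j.2 @^-1` A j)) =
     (\prod_(j <- s) P (G j.1 j.2 @^-1` A j))%E)
  (T : nat) :
  let Gvec (w : Omega) (t : nat) : 'rV[R]_d := \row_(i < d) G t i w in
  let WT (w : Omega) := sgd_iter proj grad Dset batch eta Kc b (Gvec w) W0 T in
  let WT' (w : Omega) := sgd_iter proj grad Dset' batch eta Kc b (Gvec w) W0 T in
  let tEs := tE batch b istar in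
  let inS (tau t : nat) := exists e, (tEs e <= T - 1)%N /\ (tau <= tEs e)%N /\ t = tEs e in
  forall alpha : R, 1 < alpha ->
  forall (tau : nat) (beta a : nat -> R),
    (tau < T)%N ->
    (forall t, (tau <= t < T)%N -> 0 <= a t) ->
    (forall t, (tau <= t < T)%N -> inS tau t -> 0 <= beta t <= 1) ->
    (forall t, (tau <= t < T)%N -> ~ inS tau t -> beta t = 0) ->
    Dseq batch b istar eta Kc L lam tau <= Aseq h a T tau ->
    (renyi alpha (pushforward P (fun w => rv2tuple (WT w)))
                 (pushforward P (fun w => rv2tuple (WT' w)))
     <= \sum_(e < T | (tEs e <= T - 1)%N && (tau <= tEs e)%N)
          ediv (alpha * (2 * Kc * eta / b%:R) ^+ 2) (2 * beta (tEs e) * sigma ^+ 2)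
        + \sum_(tau <= t < T)
          ediv (alpha * a t ^+ 2) (2 * sigma ^+ 2 * (1 - beta t)))%E.
Proof.
move=> Gvec WT WT' tEs inS alpha alpha1 tau beta a tauT a0 betaS betaN DA.
have al0 : 0 < alpha by rewrite (lt_trans ltr01).
have /andP[lam0 _] := hlam.
have B0 : (0 < n %/ b)%N := epoch_gt0 istar hbcover.
(* If [b = 0], then [n %/ b = 0] and the epochs would be empty. *)
have b0 : (0 < b)%N by case: (b) B0.
have cb := card_batch istar hbsize hbcover.
have Kconv x y t := @convex_set_segment R 'rV[R]_d Kset x y t hKcv.
pose N := (T * d)%N.
pose H w := hist N (flat G) N w.
pose st (y : N.-tuple R) := steer_at proj grad eta Kc b batch Dset Dset' W0 tau a (unflat y).
(* Coordinate [j] is shifted by an entry of the steering of step [j %/ d]. Beyond [N] the shift is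
   set to 0, since measurability is demanded for all [j] while the signs of [a] are known only
   before [T]. *)
pose s j (y : N.-tuple R) := if (j < N)%N then flat_entry (st y (j %/ d)%N) j else 0.
pose c := 2 * Kc * eta / b%:R.
have c0 : 0 <= c by rewrite /c divr_ge0// !mulr_ge0// ltW.
have a0' t u : (t <= T)%N -> (tau <= u < t)%N -> 0 <= a u.
  by move=> tT /andP[tu ut]; apply: a0; rewrite tu (leq_trans ut).
have mun t : measurable_vec (fun y : N.-tuple R => unflat y t).
  move=> i; rewrite (_ : (fun _ => _) = (fun y : N.-tuple R => y`_(t * d + i))).
    exact: measurable_nth.
  by apply/funext => y; rewrite mxE.
have ltjd j : (j < N)%N -> (j %/ d < T)%N.
  move=> jN; rewrite ltn_divLR// lt0n; apply: contraTneq jN => d0.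
  by rewrite /N [X in (T * X)%N]d0 muln0.
have ms j : measurable_fun setT (s j).
  rewrite /s; case: (ltnP j N) => // jN; have tT := ltjd _ jN.
  have [m1 m2] := measurable_vec_coupled Kconv hproj hL lam0 hHolder eta hKc b batch hW0
    mun Dset Dset' (fun u => a0' _ u (ltnW tT)).
  have mst : measurable_vec (fun y => st y (j %/ d)%N).
    apply: (measurable_vec_steer Kconv hproj hL lam0 hHolder) => //.
    - by move=> taut; apply: a0; rewrite taut.
    - by move=> y; exact: (coupled1_in hproj).
    - by move=> y; exact: (coupled2_in hproj).
  by rewrite /flat_entry; case: insub => [i|]; [exact: mst|exact: measurable_cst].
have s_adapted j (y z : N.-tuple R) :
    (forall i, (i < j)%N -> y`_i = z`_i) -> s j y = s j z.
  (* The steering of block [j %/ d] reads earlier blocks only, and these end before [j], as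
     [(j %/ d) * d <= j]. *)
  move=> yz; have E : st y (j %/ d)%N = st z (j %/ d)%N.
    apply: eq_steer_at => u uj; apply/rowP => i; rewrite !mxE; apply: yz.
    by apply: leq_trans (leq_trunc_div j d); exact: ltn_mulD.
  by rewrite /s E.
have unH w t : (t < T)%N -> unflat (H w) t = Gvec w t.
  by move=> tT; exact: unflat_hist.
have WTE w : sgd_iter proj grad Dset batch eta Kc b (unflat (H w)) W0 T = WT w.
  by apply: eq_sgd_iter => t tT; exact: unH.
have WTE' w : sgd_iter proj grad Dset' batch eta Kc b (unflat (H w)) W0 T = WT' w.
  by apply: eq_sgd_iter => t tT; exact: unH.
have cend g : (coupled proj grad eta Kc b batch Dset Dset' W0 tau a g T).1 =
    (coupled proj grad eta Kc b batch Dset Dset' W0 tau a g T).2.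
  apply: (coupled_end Kconv hproj hL lam0 hHolder heta hKc cb b0 hadj hW0
    _ _ _ hh tauT a0 DA) => [t|e|t tB].
  - exact: (notin_batch_lt_tE0 hbdisj hbcover).
  - exact: mem_batch_tE.
  - by exists (t %/ (n %/ b))%N; exact: (mem_batchE hbdisj hbcover).
(* The crux: under the shifted noise the [D]-run is the first component of the pair, which at time
   [T] meets the second, that is the [D']-run under the original noise. *)
have unshiftE w : sgd_iter proj grad Dset batch eta Kc b
    (unflat (unshift s N (H w))) W0 T = WT' w.
  rewrite -WTE' -(coupled2E proj grad eta Kc b batch Dset Dset' W0 tau a).
  rewrite -cend coupled1E; apply: eq_sgd_iter => t tT.
  apply/rowP => i; have tdN : (t * d + i < N)%N := ltn_mulD i tT.
  rewrite !mxE nth_mktup// tdN; congr (_ - _).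
  by rewrite /s tdN divn_mulD flat_entry_mulD.
pose M w := expR (log_weight sigma s N (H w)).
have mflat := measurable_flat hGmeas.
have mH : measurable_fun setT H by exact: measurable_hist.
have mM : measurable_fun setT M.
  apply: measurableT_comp => //.
  exact: (measurableT_comp (measurable_log_weight sigma ms N) mH).
have mGvec t : measurable_vec (Gvec ^~ t).
  move=> i; rewrite (_ : (fun _ => _) = G t i) //.
  by apply/funext => w; rewrite mxE.
have mZ : measurable_fun setT (fun w => rv2tuple (WT w)).
  apply: measurable_rv2tuple.
  exact: (measurable_vec_sgd Kconv hproj hL lam0 hHolder eta hKc b batch hW0 mGvec).
have mZ' : measurable_fun setT (fun w => rv2tuple (WT' w)).
  apply: measurable_rv2tuple.
  exact: (measurable_vec_sgd Kconv hproj hL lam0 hHolder eta hKc b batch hW0 mGvec).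
have girs := @girsanov_hist R sigma _ Omega P N (flat G) hsigma mflat
  (flat_law hGlaw) (flat_indep hGindep).
(* Girsanov's formula for the indicator of [W_T] in [A], read as a function of the noise tuple. *)
have ZM A : measurable A -> P ((fun w => rv2tuple (WT w)) @^-1` A) =
    (\int[P]_w (M w * \1_A (rv2tuple (WT' w)))%:E)%E.
  move=> mA.
  pose f (y : N.-tuple R) : \bar R :=
    (\1_A (rv2tuple (sgd_iter proj grad Dset batch eta Kc b (unflat y) W0 T)))%:E.
  have mf : measurable_fun setT f.
    apply/measurable_EFinP.
    have mi : measurable_fun setT (\1_A : d.-tuple R -> R) by exact: measurable_indic.
    apply: (measurableT_comp mi); apply: measurable_rv2tuple.
    exact: (measurable_vec_sgd Kconv hproj hL lam0 hHolder eta hKc b batch hW0 mun).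
  have f0 y : (0 <= f y)%E by rewrite lee_fin indicE ler0n.
  have := girs _ ms s_adapted N f (leqnn N) mf f0.
  under eq_integral do rewrite /f unshiftE -EFinM.
  under [in X in _ = X]eq_integral do rewrite /f WTE.
  move=> ->.
  transitivity (\int[P]_w (\1_((fun w => rv2tuple (WT w)) @^-1` A) w)%:E)%E => //.
  rewrite integral_indic ?setIT//.
  by have := mZ measurableT _ mA; rewrite setTI.
pose u t := alpha * (a t + c * (istar \in batch t)%:R) ^+ 2 / (2 * sigma ^+ 2).
pose C := \sum_(tau <= t < T) u t.
have s2 : 0 < 2 * sigma ^+ 2 by rewrite mulr_gt0// exprn_gt0.
(* The deterministic bound: it holds for every tuple, not just on average. *)
have sumS (y : N.-tuple R) : alpha * (\sum_(j < N) s j y ^+ 2 / (2 * sigma ^+ 2)) <= C.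
  rewrite -mulr_suml.
  have -> : \sum_(j < N) s j y ^+ 2 = \sum_(t < T) enorm (st y t) ^+ 2.
    rewrite -sum_sqr_flat_entry; apply: eq_bigr => j _.
    by rewrite /s ltn_ord.
  rewrite /C /u -mulr_suml -mulr_sumr mulrA ler_wpM2r ?invr_ge0 ?(ltW s2)//.
  rewrite ler_wpM2l ?(ltW al0)//.
  rewrite big_geq_mkord [leRHS]big_mkcond/=; apply: ler_sum => t _.
  have := enorm_steer_le grad heta hKc batch b0 hadj a0
    (coupled proj grad eta Kc b batch Dset Dset' W0 tau a (unflat y) t).1
    (coupled proj grad eta Kc b batch Dset Dset' W0 tau a (unflat y) t).2 (ltn_ord t).
  rewrite -/(st y t); case: ifPn => taut Hs.
    by rewrite ler_sqr ?nnegrE ?enorm_ge0// (le_trans (enorm_ge0 _) Hs).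
  have -> : enorm (st y t) = 0 by apply/le_anti; rewrite Hs enorm_ge0.
  by rewrite expr0n.
pose s' j (y : N.-tuple R) := alpha * s j y.
have ms' j : measurable_fun setT (s' j) by exact: measurable_funM.
have s'_adapted j (y z : N.-tuple R) :
    (forall i, (i < j)%N -> y`_i = z`_i) -> s' j y = s' j z.
  by move=> yz; rewrite /s' (s_adapted _ _ _ yz).
(* The formula for the shift [alpha * s] and the constant function 1: its weight has mean one. *)
have int1 : (\int[P]_w (expR (log_weight sigma s' N (H w)))%:E = 1)%E.
  have := girs _ ms' s'_adapted N (fun=> 1%E) (leqnn N).
  under eq_integral do rewrite mule1.
  by move=> ->//; rewrite integral_cst//= probability_setT mule1.
have moment : (\int[P]_w (M w `^ alpha)%:E <= (expR ((alpha - 1) * C))%:E)%E.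
  have mlw : measurable_fun setT (fun w => (expR (log_weight sigma s' N (H w)))%:E).
    apply/measurable_EFinP; apply: measurableT_comp => //.
    exact: (measurableT_comp (measurable_log_weight sigma ms' N) mH).
  have lw0 w : [set: Omega] w -> (0 <= (expR (log_weight sigma s' N (H w)))%:E)%E.
    by rewrite lee_fin expR_ge0.
  have eC : (0 <= (expR ((alpha - 1) * C))%:E)%E by rewrite lee_fin expR_ge0.
  rewrite -[leRHS]mule1 -int1 -ge0_integralZl//.
  apply: ge0_le_integral => //.
  - by move=> w _; rewrite lee_fin powR_ge0.
  - by apply/measurable_EFinP; exact: (measurableT_comp (measurable_powR alpha) mM).
  - exact: measurable_funeM.
  move=> w _; rewrite -EFinM lee_fin /M -expRM -expRD ler_expR.
  (* The linear terms agree, and the quadratic ones differ by a factor [alpha ^+ 2 - alpha]. *)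
  have -> : log_weight sigma s N (H w) * alpha = log_weight sigma s' N (H w) +
      (alpha - 1) * (alpha * (\sum_(j < N) s j (H w) ^+ 2 / (2 * sigma ^+ 2))).
    rewrite /log_weight mulr_suml !mulr_sumr -big_split/=.
    by apply: eq_bigr => j _; rewrite /s'; field; rewrite gt_eqF.
  by rewrite addrC lerD2r ler_wpM2l// subr_ge0 ltW.
apply: (le_trans (renyi_le mZ mZ' mM (fun w => expR_ge0 _) ZM alpha1 moment)).
pose F t := ediv (alpha * (2 * Kc * eta / b%:R) ^+ 2) (2 * beta t * sigma ^+ 2).
rewrite [X in (_ <= X + _)%E](sum_epochs istar hbdisj hbcover F tauT) big_mkcond/=.
rewrite -big_split/= /C -sumEFin !big_nat; apply: lee_sum => t tT.
have at0 : 0 <= a t by exact: a0.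
(* The comparison is now step by step: [beta] splits the cost only where [istar] is used; elsewhere
   [beta t = 0] and the two terms are equal. *)
rewrite /u; case: ifPn => tB.
  rewrite mulr1; apply: ediv_split => //; apply: betaS => //.
  exists (t %/ (n %/ b))%N.
  have tE := mem_batchE hbdisj hbcover tB; move: tT => /andP[taut tT].
  by rewrite /tEs -tE; split=> //; rewrite subn1 -ltnS prednK// (leq_ltn_trans _ tT).
rewrite mulr0 addr0 add0e betaN ?ediv_beta0// => -[e [_ [_ te]]].
by move: tB; rewrite te mem_batch_tE.
Qed.
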